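(* Let $$R=\frac{\mathbb Z[x_0,x_1,x_2,u_0,u_1,u_2]}{(x_0u_1-x_1u_0,\ x_0u_2-x_2u_0,\ x_1u_2-x_2u_1)^2},$$ the denominator being the square of the ideal generated by the three displayed elements. Then $R$ is a non-reduced ring of dimension $5$, and there is a prime ideal $J\subset R$ of codimension $1$ such that the local cohomology module $H^2_J(R)$ has infinitely many minimal primes.
   Context: Dimension means Krull dimension and the codimension of a prime ideal is its height. The minimal primes of an $R$-module $M$ are the minimal elements (under inclusion) of $\operatorname{Supp}_R M\subset\operatorname{Spec}(R)$. *)

(* Defs.v *)
From HB Require Import structures.
From mathcomp Require Import all_boot all_order all_algebra.
From mathcomp Require Import generic_quotient ring_quotient.
From mathcomp Require Import boolp classical_sets cardinality.
From mathcomp Require Import mpoly.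

Set Implicit Arguments.
Unset Strict Implicit.
Unset Printing Implicit Defensive.

Import GRing.Theory.

Local Open Scope classical_set_scope.
Local Open Scope ring_scope.

Section Ideals.
Variable R : comNzRingType.
Implicit Types (I J P Q S : set R) (n d h : nat).

Definition ideal I : Prop :=
  [/\ I 0, (forall a b, I a -> I b -> I (a + b))
         & (forall r a, I a -> I (r * a))].

Definition prime_ideal P : Prop :=
  [/\ ideal P, ~ P 1 & forall a b, P (a * b) -> P a \/ P b].

Definition ideal_gen S : set R := smallest ideal S.

Definition ideal_mul I J : set R := ideal_gen [set a * b | a in I & b in J].

Definition ideal_pow I n : set R := iter n (ideal_mul I) setT.

Definition reduced : Prop := forall (a : R) n, a ^+ n = 0 -> a = 0.

(* A strictly increasing chain [p 0 < ... < p n] of prime ideals; its length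
   is [n], the number of strict inclusions. Values beyond [n] are ignored. *)
Definition prime_chain n (p : nat -> set R) : Prop :=
  (forall i, (i <= n)%N -> prime_ideal (p i)) /\
  (forall i, (i < n)%N -> p i `<` p i.+1).

Definition krull_dim_is d : Prop :=
  (exists p, prime_chain d p) /\
  (forall n p, prime_chain n p -> (n <= d)%N).

Definition height_is P h : Prop :=
  (exists2 p, prime_chain h p & p h = P) /\
  (forall n p, prime_chain n p -> p n = P -> (n <= h)%N).

Lemma ideal_genP S : ideal (ideal_gen S).
Proof.
split=> [I [[]] //|a b Ia Ib I SI|r a Ia I SI].
- by case: (SI) => -[_ addI _] _; apply: addI; [apply: Ia | apply: Ib].
- by case: (SI) => -[_ _ mulI] _; apply: mulI; apply: Ia.
Qed.

Lemma sub_ideal_gen S : S `<=` ideal_gen S.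
Proof. exact: sub_smallest. Qed.

Lemma ideal_gen_sub S I : ideal I -> S `<=` I -> ideal_gen S `<=` I.
Proof. by move=> idI SI x; apply. Qed.

Lemma ideal_pow_ideal J n : ideal (ideal_pow J n).
Proof. by case: n => [|n]; [split | apply: ideal_genP]. Qed.

Lemma ideal_pow_anti J m n : (m <= n)%N -> ideal_pow J n `<=` ideal_pow J m.
Proof.
move=> /subnK <-; elim: (n - m)%N => [//|k IH].
apply: subset_trans IH; rewrite addSn.
apply: ideal_gen_sub; first exact: ideal_pow_ideal.
by move=> _ [a _ [b Jb <-]]; have [_ _] := ideal_pow_ideal J (k + m); apply.
Qed.

End Ideals.

Section SubQuotient.
Variables (R : comNzRingType) (M : lmodType R) (U : submodClosed M).

Definition submodule := {m : M | m \in U}.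
HB.instance Definition _ := SubChoice.on submodule.
HB.instance Definition _ := [SubChoice_isSubLmodule of submodule by <:].

(* [{quot _}] only needs an additive subgroup; a submodule is one. *)
Definition zmod_pred : {pred M} := [pred m | m \in U].

Lemma zmod_pred_closed : zmod_closed zmod_pred.
Proof.
split=> [|x y]; rewrite !inE ?rpred0 // => Ux Uy.
by rewrite rpredD // -scaleN1r rpredZ.
Qed.
HB.instance Definition _ := GRing.isZmodClosed.Build M zmod_pred zmod_pred_closed.

Definition quotmod := Quotient.quot zmod_pred.
HB.instance Definition _ := ZmodQuotient.on quotmod.

Local Open Scope quotient_scope.

Definition quotmod_scale (r : R) : quotmod -> quotmod := lift_op1 quotmod ( *:%R r).

Lemma pi_scale r : {morph \pi_quotmod : x / r *: x >-> quotmod_scale r x}.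
Proof.
move=> x; rewrite /quotmod_scale; unlock; apply/eqP.
rewrite -Quotient.idealrBE -scalerBr inE rpredZ //.
have : \pi_quotmod (repr (\pi_quotmod x)) == \pi_quotmod x by rewrite reprK.
by rewrite eq_sym -Quotient.idealrBE.
Qed.

Fact quotmod_scaleA a b v :
  quotmod_scale a (quotmod_scale b v) = quotmod_scale (a * b) v.
Proof. by rewrite -[v]reprK -!pi_scale scalerA. Qed.

Fact quotmod_scale1 : left_id 1 quotmod_scale.
Proof. by move=> v; rewrite -[v]reprK -!pi_scale scale1r. Qed.

Fact quotmod_scaleDr : right_distributive quotmod_scale +%R.
Proof.
by move=> a u v; rewrite -[u]reprK -[v]reprK -raddfD -!pi_scale scalerDr raddfD.
Qed.

Fact quotmod_scaleDl v : {morph quotmod_scale^~ v : a b / a + b}.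
Proof. by move=> a b; rewrite -[v]reprK -!pi_scale scalerDl raddfD. Qed.

HB.instance Definition _ := GRing.Zmodule_isLmodule.Build R quotmod
  quotmod_scaleA quotmod_scale1 quotmod_scaleDr quotmod_scaleDl.

End SubQuotient.

Record cochain_complex (R : comNzRingType) := CochainComplex {
  cterm :> nat -> lmodType R;
  cdiff : forall n, {linear cterm n -> cterm n.+1};
  cdiffK : forall n x, cdiff n.+1 (cdiff n x) = 0
}.

Section Kernel.
Variables (R : comNzRingType) (M N : lmodType R) (f : {linear M -> N}).

Definition ker_pred : {pred M} := [pred m | f m == 0].

Lemma ker_pred_closed : subsemimod_closed ker_pred.
Proof.
split=> [|r x]; last by rewrite !inE linearZ /= => /eqP->; rewrite scaler0.
split=> [|x y]; first by rewrite inE linear0.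
by rewrite !inE linearD => /eqP-> /eqP->; rewrite addr0.
Qed.
HB.instance Definition _ := GRing.isSubSemiModClosed.Build R M ker_pred ker_pred_closed.

Definition kermod : lmodType R := submodule ker_pred.

End Kernel.

Section Cohomology.
Variables (R : comNzRingType) (C : cochain_complex R) (i : nat).

Definition cocycles : lmodType R := kermod (cdiff C i).

Definition is_coboundary j : C j -> Prop :=
  match j with
  | 0 => fun c => c = 0
  | k.+1 => fun c => exists b : C k, c = cdiff C k b
  end.

Lemma is_coboundary0 j : @is_coboundary j 0.
Proof. by case: j => [//|j]; exists 0; rewrite linear0. Qed.

Lemma is_coboundaryD j (x y : C j) :
  is_coboundary x -> is_coboundary y -> is_coboundary (x + y).
Proof.
case: j x y => [|j] x y /= => [-> ->|[b ->] [c ->]]; first by rewrite addr0.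
by exists (b + c); rewrite linearD.
Qed.

Lemma is_coboundaryZ j r (x : C j) : is_coboundary x -> is_coboundary (r *: x).
Proof.
case: j x => [|j] x /= => [->|[b ->]]; first by rewrite scaler0.
by exists (r *: b); rewrite linearZ.
Qed.

Definition cobound_pred : {pred cocycles} :=
  [pred z : cocycles | `[< is_coboundary (\val z) >]].

Lemma cobound_pred_closed : subsemimod_closed cobound_pred.
Proof.
split=> [|r x]; last first.
  by rewrite !inE => Bx; exact: (is_coboundaryZ r Bx).
split=> [|x y]; first by rewrite inE; exact: (is_coboundary0 i).
by rewrite !inE => Bx By; exact: (is_coboundaryD Bx By).
Qed.
HB.instance Definition _ :=
  GRing.isSubSemiModClosed.Build R cocycles cobound_pred cobound_pred_closed.

Definition cohomology : lmodType R := quotmod cobound_pred.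

End Cohomology.

Section Torsion.
Variables (R : comNzRingType) (J : set R).

Section Object.
Variable M : lmodType R.

Definition torsion_pred : {pred M} :=
  [pred m | `[< exists n, forall a, ideal_pow J n a -> a *: m = 0 >]].

Lemma torsion_pred_closed : subsemimod_closed torsion_pred.
Proof.
split=> [|r x]; rewrite ?inE; last first.
  move=> [n xn]; exists n => a /xn ax0.
  by rewrite scalerA mulrC -scalerA ax0 scaler0.
split=> [|x y]; first by rewrite inE; exists 0%N => a _; rewrite scaler0.
rewrite !inE => -[n xn] [k yk]; exists (n + k)%N => a Ja.
rewrite scalerDr xn ?yk ?addr0 //; apply: ideal_pow_anti Ja.
  exact: leq_addl.
exact: leq_addr.
Qed.
HB.instance Definition _ :=
  GRing.isSubSemiModClosed.Build R M torsion_pred torsion_pred_closed.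

(* Gamma_J(M), the elements killed by some power of J. *)
Definition torsion : lmodType R := submodule torsion_pred.

End Object.

Section Morphism.
Variables (M N : lmodType R) (f : {linear M -> N}).

Fact torsion_map_subproof (m : torsion M) : f (\val m) \in @torsion_pred N.
Proof.
have := valP m; rewrite !inE => -[n mn].
by exists n => a /mn am0; rewrite -linearZ am0 linear0.
Qed.

Definition torsion_map (m : torsion M) : torsion N :=
  Sub (f (\val m)) (torsion_map_subproof m).

Fact torsion_map_linear : linear torsion_map.
Proof. by move=> r x y; apply: val_inj; rewrite /= linearP. Qed.
HB.instance Definition _ :=
  GRing.isLinear.Build R (torsion M) (torsion N) _ torsion_map torsion_map_linear.

End Morphism.

Section Complex.
Variable C : cochain_complex R.

Fact torsion_diffK n x :
  torsion_map (cdiff C n.+1) (torsion_map (cdiff C n) x) = 0.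
Proof. by apply: val_inj; rewrite /= cdiffK. Qed.

Definition torsion_complex : cochain_complex R :=
  @CochainComplex R (fun n => torsion (C n)) (fun n => torsion_map (cdiff C n))
    torsion_diffK.

End Complex.
End Torsion.

Definition injective_module (R : comNzRingType) (E : lmodType R) : Prop :=
  forall (A B : lmodType R) (f : {linear A -> B}) (g : {linear A -> E}),
    injective f -> exists h : {linear B -> E}, forall a, h (f a) = g a.

(* 0 -> M -> I^0 -> I^1 -> ... exact with every I^n injective. *)
Record injective_resolution (R : comNzRingType) (M : lmodType R) :=
  InjectiveResolution {
    res_complex :> cochain_complex R;
    res_aug : {linear M -> res_complex 0};
    res_inj : forall n, injective_module (res_complex n);
    res_aug_inj : injective res_aug;
    res_exact0 : forall x,
      cdiff res_complex 0 x = 0 <-> exists m, x = res_aug m;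
    res_exact : forall n x,
      cdiff res_complex n.+1 x = 0 -> exists y, x = cdiff res_complex n y
  }.

(* H^i_J(M) = H^i(Gamma_J(I)), computed from an injective resolution I of M;
   up to isomorphism it does not depend on I. *)
Definition local_cohomology (R : comNzRingType) (J : set R) (M : lmodType R)
    (I : injective_resolution M) (i : nat) : lmodType R :=
  cohomology (torsion_complex J I) i.

Section Support.
Variables (R : comNzRingType) (M : lmodType R).
Implicit Types P Q : set R.

(* Equality of the fractions x.1 / x.2 and y.1 / y.2 in the localization of M
   at P, where the denominators lie outside P. *)
Definition eq_frac P (x y : M * R) : Prop :=
  exists2 t, ~ P t & t *: (y.2 *: x.1 - x.2 *: y.1) = 0.

(* The primes P with M_P <> 0. *)
Definition support : set (set R) :=
  [set P | prime_ideal P /\ exists2 x : M * R, ~ P x.2 & ~ eq_frac P x (0, 1)].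

Definition minimal_primes : set (set R) :=
  [set P | support P /\ forall Q, support Q -> Q `<=` P -> Q = P].

End Support.

Notation zpoly6 := {mpoly int[6]}.

Definition xvar (k : nat) : zpoly6 := 'X_(inord k).
Definition uvar (k : nat) : zpoly6 := 'X_(inord (3 + k)%N).

Definition xu_minor (i j : nat) : zpoly6 := xvar i * uvar j - xvar j * uvar i.

Definition minors_ideal : set zpoly6 :=
  ideal_gen [set xu_minor 0%N 1%N; xu_minor 0%N 2%N; xu_minor 1%N 2%N].

Definition minors_sq_pred : {pred zpoly6} :=
  [pred p | `[< ideal_pow minors_ideal 2 p >]].

Lemma minors_sq_closed : idealr_closed minors_sq_pred.
Proof.
have [I0 ID IM] := ideal_pow_ideal minors_ideal 2.
split=> [||a u v]; first by rewrite inE.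
- apply/negP; rewrite inE => I1.
  pose K : set zpoly6 := [set p | p@_0%MM = 0].
  have idK : ideal K.
    by split=> [|a b Ka Kb|r a Ka]; rewrite /K /= ?mcoeff0 // ?rmorphD ?rmorphM /= ?Ka ?Kb ?addr0 ?mulr0.
  have MK : minors_ideal `<=` K.
    apply: ideal_gen_sub => // p; rewrite /K /=.
    by case=> [[->|->]|->]; rewrite /xu_minor raddfB /= !rmorphM /= !mcoeffX !mnm1_eq0 !mul0r subrr.
  have /(_ 1 I1) : ideal_pow minors_ideal 2 `<=` K.
    apply: ideal_gen_sub => // _ [a Ia [b _ <-]].
    by rewrite /K /= rmorphM /= MK // mul0r.
  by rewrite /K /= mcoeff1 eqxx.
- by rewrite !inE => Iu Iv; apply: ID => //; apply: IM.
Qed.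
HB.instance Definition _ := isIdealr.Build zpoly6 minors_sq_pred minors_sq_closed.

(* R = Z[x0,x1,x2,u0,u1,u2] / I^2, with I the ideal of 2 x 2 minors. *)
Definition ringR : comNzRingType := {ideal_quot minors_sq_pred}.

(* Main.v *)
(* Write S = R_red, so that R is an extension of S by the conormal module I/I^2 of
   the ideal I of 2 x 2 minors, and take J = (x_0, x_1, x_2). Off V(J) the scheme
   Spec S is (A^3 - 0) x A^1 with coordinates x and t, where u_i = t x_i, and the
   conormal sheaf is the kernel of (x_0, x_1, x_2) : O^3 -> O. As x is a regular
   sequence in Z[x, t], this gives H^2_J(S) = 0 and H^2_J(I/I^2) = Z[t]; the
   connecting map H^1_J(S) -> Z[t] is f |-> (df/dt)(0, t), because the lifts
   f(x, u_i/x_i) and f(x, u_j/x_j) of f differ by df/dt (u_i/x_i - u_j/x_j).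
   Hence H^2_J(R) = Z[t] / (d/dt) Z[t] is the direct sum of the Z/k, with x and u
   acting by 0: its support consists of the maximal ideals (p, x, u).

   For an arbitrary injective resolution, classes of H^2_J are compared with
   Koszul cocycles on x_i^n; since R is Noetherian the Koszul homology modules form
   pro-zero systems, which is what extending maps into injectives requires.

   Dimensions are bounded by transcendence degree: an element of P_1 - P_0 and
   elements algebraically independent modulo P_1 are together independent
   modulo P_0, and a domain quotient of R is generated by 4 elements after
   inverting one of them, so at most 4 elements are independent modulo a prime. *)

Require Import Defs.
From HB Require Import structures.
From mathcomp Require Import all_boot all_order all_algebra.
From mathcomp Require Import generic_quotient ring_quotient.
From mathcomp Require Import boolp classical_sets cardinality.
From mathcomp Require Import mpoly ring zify.

Set Implicit Arguments.
Unset Strict Implicit.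
Unset Printing Implicit Defensive.

Import GRing.Theory.

Local Open Scope classical_set_scope.
Local Open Scope ring_scope.

(** Minimality of the primes [(p, x, u)] is drawn from annihilators alone: every class of [H^2_J(R)]
    is killed by the elements without constant term and by some positive integer, while the class of
    [t^n] is killed only by elements whose constant term is divisible by [n + 1]. So the comparison
    with Koszul cocycles is made one class at a time, by implications between vanishing statements.
    As [J] has height 1, [x_0, x_1, x_2] is far from regular in [R], and divisions cost extra powers
    of the [x_i]. An element of [R] is studied through its restriction to [u = t x] and the
    restrictions of its derivatives in the [u_l]. These data descend to [R] because a derivation
    along the restriction kills [I^2], they determine the element up to [x_i]-power torsion, and the
    chain rule [d/dt = sum of x_l d/du_l] links them: it is the source of both the conormal kernel
    and the [df/dt] of the connecting map. For the dimension, coefficients are integers modulo the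
    prime. A chain can enlarge the contraction to the integers only once, and that step yields no
    new independent element; hence 5 = 4 + 1. *)

(** * Noetherian rings and Koszul relations *)

(* The ascending chain condition, phrased on sequences of generators. *)
Definition noetherian (R : comNzRingType) : Prop :=
  forall f : nat -> R, exists m (c : nat -> R), f m = \sum_(i < m) c i * f i.

Lemma noetherian_image (Q S : comNzRingType) (h : {rmorphism Q -> S}) :
  noetherian Q -> (forall s, exists q, h q = s) -> noetherian S.
Proof.
move=> noQ hsurj f.
have [g hg] := choice (fun n => hsurj (f n)).
have [m [c gm]] := noQ g; exists m, (h \o c).
rewrite -hg gm rmorph_sum /=.
by apply: eq_bigr => i _; rewrite rmorphM hg.
Qed.

(** Let [a] be a nonzero combination of least absolute value, formed from the first [m] terms; the
    remainder of [f m] modulo [a] is again a combination, hence 0. *)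
Lemma noetherian_int : noetherian int.
Proof.
move=> f.
pose I (a : int) := exists m (c : nat -> int), a = \sum_(i < m) c i * f i.
have If m : I (f m).
  exists m.+1, (fun i => (i == m)%:R); rewrite big_ord_recr /= eqxx mul1r big1 ?add0r //.
  by move=> i _; rewrite ltn_eqF ?mul0r // ltn_ord.
have If0 m : f m = 0 -> exists m (c : nat -> int), f m = \sum_(i < m) c i * f i.
  by move=> fm0; exists m, (fun=> 0); rewrite fm0 big1 // => i _; rewrite mul0r.
have [f00|f0N0] := eqVneq (f 0%N) 0; first exact: (If0 0%N).
pose V (k : nat) := `[< exists a, [/\ I a, a != 0 & absz a = k] >].
have exV : exists k, V k by exists `|f 0%N|%N; apply/asboolP; exists (f 0%N).
case: (ex_minnP exV) => k /asboolP[a [[m [c aE]] a0 ak]] kmin.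
have [q [r [fE rlt]]] : exists q r : int, f m = q * a + r /\ (absz r < absz a)%N.
  exists (divz (f m) a), (modz (f m) a); split; first exact: divz_eq.
  by have := ltz_mod (f m) a0; have := modz_ge0 (f m) a0; lia.
have rE : r = \sum_(i < m.+1) ((if (i < m)%N then - q * c i else 1)) * f i.
  rewrite big_ord_recr /= ltnn mul1r (eq_bigr (fun i : 'I_m => - q * (c i * f i))).
    by rewrite -mulr_sumr -aE fE; ring.
  by move=> i _; rewrite ltn_ord mulrA.
have [r0|rN0] := eqVneq r 0.
  exists m, (fun i => q * c i); rewrite fE r0 addr0 aE mulr_sumr.
  by apply: eq_bigr => i _; rewrite mulrA.
have Vr : V (absz r).
  by apply/asboolP; exists r; split=> //; exists m.+1, (fun i => (if (i < m)%N then - q * c i else 1)).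
by have := kmin _ Vr; lia.
Qed.

Section HilbertBasis.
Variable R : comNzRingType.

(** If no term of [f] were a combination of earlier ones, elements [h n] of least size could be
    chosen successively in the ideal [I] outside the span of the previous ones. A relation among
    their leading coefficients then gives [h m - g], still outside that span but smaller. *)
Lemma noetherian_poly : noetherian R -> noetherian {poly R}.
Proof.
move=> noR f.
pose spanned (h : nat -> {poly R}) m p := exists c : nat -> {poly R}, p = \sum_(i < m) c i * h i.
have sp_widen (h : nat -> {poly R}) m n p : (m <= n)%N -> spanned h m p -> spanned h n p.
  move=> mn [c ->]; exists (fun i => if (i < m)%N then c i else 0).
  rewrite (big_ord_widen n (fun i => c i * h i) mn) big_mkcond /=.
  by apply: eq_bigr => i _; case: ifP; rewrite ?mul0r.
have spD (h : nat -> {poly R}) m p q : spanned h m p -> spanned h m q -> spanned h m (p + q).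
  move=> [c ->] [d ->]; exists (fun i => c i + d i); rewrite -big_split /=.
  by apply: eq_bigr => i _; rewrite mulrDl.
have spZ (h : nat -> {poly R}) m p q : spanned h m p -> spanned h m (q * p).
  move=> [c ->]; exists (fun i => q * c i); rewrite mulr_sumr.
  by apply: eq_bigr => i _; rewrite mulrA.
have sp0 (h : nat -> {poly R}) m : spanned h m 0.
  by exists (fun=> 0); rewrite big1 // => i _; rewrite mul0r.
have sp_gen (h : nat -> {poly R}) m i : (i < m)%N -> spanned h m (h i).
  move=> im; exists (fun j => (j == i)%:R); rewrite (bigD1 (Ordinal im)) //= eqxx mul1r.
  by rewrite big1 ?addr0 // => j; rewrite -val_eqE /= => /negbTE->; rewrite mul0r.
have sp_sum (h : nat -> {poly R}) m k (F : nat -> {poly R}) :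
    (forall i, (i < k)%N -> spanned h m (F i)) -> spanned h m (\sum_(i < k) F i).
  move=> hF; apply: (big_ind (spanned h m)) => // [p q|i _]; [exact: spD|exact: hF].
apply: contrapT => Nf.
have {}Nf m : ~ spanned f m (f m) by move=> [c fm]; apply: Nf; exists m, c.
pose I p := exists m, spanned f m p.
have addI p q : I p -> I q -> I (p + q).
  move=> [m pm] [n qn]; exists (maxn m n).
  by apply: spD; [apply: sp_widen pm|apply: sp_widen qn]; rewrite ?leq_maxl ?leq_maxr.
have mulI p q : I p -> I (q * p) by move=> [m pm]; exists m; apply: spZ.
pose good (s : seq {poly R}) p :=
  [/\ I p, ~ spanned (nth 0 s) (size s) p
    & forall q, I q -> ~ spanned (nth 0 s) (size s) q -> (size p <= size q)%N].
have ex_good s : (forall p, p \in s -> I p) -> exists p, good s p.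
  move=> Is.
  have [M sM] : exists M, forall p, p \in s -> spanned f M p.
    elim: s Is => [|p s IHs] Is; first by exists 0%N.
    have [M sM] := IHs (fun q qs => Is q (mem_behead (s := p :: s) qs)).
    have [m pm] := Is p (mem_head p s).
    exists (maxn m M) => q; rewrite inE => /predU1P[->|/sM qM].
      by apply: sp_widen pm; rewrite leq_maxl.
    by apply: sp_widen qM; rewrite leq_maxr.
  pose V k := `[< exists2 p, I p /\ ~ spanned (nth 0 s) (size s) p & size p = k >].
  have exV : exists k, V k.
    exists (size (f M)); apply/asboolP; exists (f M) => //; split.
      by exists M.+1; apply: sp_gen.
    move=> [c fM]; apply: (Nf M); rewrite fM; apply: (sp_sum _ _ _ (fun i => c i * s`_i)).
    by move=> i iS; apply: spZ; apply: sM; apply: mem_nth.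
  case: (ex_minnP exV) => k /asboolP[p [Ip Np] pk] kmin; exists p; split=> // q Iq Nq.
  by rewrite pk; apply: kmin; apply/asboolP; exists q.
(* The default 0 makes the choice total; the lists [S n] contain only elements of [I], so it never
   occurs there. *)
have ex_nxt s : exists p, (forall q, q \in s -> I q) -> good s p.
  have [Is|NIs] := EM (forall p, p \in s -> I p); last by exists 0.
  by have [p gp] := ex_good s Is; exists p.
have [nxt nxtP] := choice ex_nxt.
pose S n := iter n (fun s => rcons s (nxt s)) [::].
pose h n := nxt (S n).
have sizeS n : size (S n) = n by elim: n => //= n IHn; rewrite size_rcons IHn.
have nthS n i : (i < n)%N -> (S n)`_i = h i.
  elim: n => // n IHn; rewrite ltnS leq_eqVlt /= nth_rcons sizeS => /predU1P[->|lt_in].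
    by rewrite ltnn eqxx.
  by rewrite lt_in IHn.
have IS n p : p \in S n -> I p.
  elim: n p => // n IHn p; rewrite /= mem_rcons inE => /predU1P[->|/IHn//].
  by have [] := nxtP _ IHn.
have goodh n : good (S n) (h n) := nxtP _ (IS n).
have spS n p : spanned (nth 0 (S n)) (size (S n)) p <-> spanned h n p.
  by split=> -[c ->]; exists c; rewrite sizeS; apply: eq_bigr => i _; rewrite nthS.
have Ih n : I (h n) by have [] := goodh n.
have Nh n : ~ spanned h n (h n) by have [_ N _] := goodh n; rewrite -spS.
have minh n q : I q -> ~ spanned h n q -> (size (h n) <= size q)%N.
  by move=> Iq Nq; have [_ _] := goodh n; apply=> //; rewrite spS.
have szh i n : (i <= n)%N -> (size (h i) <= size (h n))%N.
  by move=> le_in; apply: minh => // /(sp_widen _ _ _ _ le_in)/Nh.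
have [m [c cE]] := noR (fun n => lead_coef (h n)).
pose g := \sum_(i < m) (c i)%:P * 'X^(size (h m) - size (h i)) * h i.
have spg : spanned h m g.
  by exists (fun i => (c i)%:P * 'X^(size (h m) - size (h i))).
have h0 : h m != 0 by apply: contra_notN (Nh m) => /eqP->.
have szg : (size g <= size (h m))%N.
  apply: (leq_trans (size_sum _ _ _)); apply/bigmax_leqP => i _.
  rewrite -mulrA mul_polyC; apply: (leq_trans (size_scale_leq _ _)).
  rewrite mulrC; apply: (leq_trans (size_mul_leq _ _)); rewrite size_polyXn.
  by have := szh i m (ltnW (ltn_ord i)); lia.
pose r := h m - g.
have hg : r`_(size (h m)).-1 = 0.
  rewrite /r coefB -/(lead_coef (h m)) cE /g coef_sum -sumrB big1 // => i _.
  rewrite -mulrA coefCM mulrC ['X^_ * _]mulrC coefMXn.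
  have hi0 : h i != 0 by apply: contra_notN (Nh i) => /eqP->.
  have := szh i m (ltnW (ltn_ord i)).
  have := h0; have := hi0; rewrite -!size_poly_gt0 => h1 h2 h3.
  rewrite ifF; last by lia.
  rewrite /lead_coef (_ : (_ - _)%N = (size (h i)).-1); last by lia.
  by rewrite mulrC subrr.
have : (size (h m) <= size r)%N.
  apply: minh => [|spN]; last first.
    by apply: (Nh m); rewrite -(subrK g (h m)); apply: spD.
  apply: (addI) => //; rewrite -mulN1r; apply: (mulI).
  apply: (big_ind I) => [|p q|i _]; [|exact: addI|exact: mulI].
  by exists 0%N, (fun=> 0); rewrite big_ord0.
move: h0; rewrite -size_poly_gt0 => h0; rewrite leqNgt => /negP; apply.
rewrite -(prednK h0) ltnS; apply/leq_sizeP => j; rewrite leq_eqVlt => /predU1P[<-//|lt_j].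
rewrite nth_default //; apply: (leq_trans (size_polyD _ _)); rewrite size_polyN geq_max.
have hj : (size (h m) <= j)%N by move: lt_j h0; case: (size (h m)) => //.
by rewrite hj (leq_trans szg hj).
Qed.

End HilbertBasis.

(** [Q] is an iterated polynomial ring over the integers, one variable for each element of [s]. *)
Lemma noetherian_adjoin (S : comNzRingType) (s : seq S) :
  exists (Q : comNzRingType) (h : {rmorphism Q -> S}),
    noetherian Q /\ forall a, a \in s -> exists q, h q = a.
Proof.
elim: s => [|a s [Q [h [noQ hs]]]].
  by exists int, intr; split=> //; exact: noetherian_int.
exists {poly Q}, (horner_eval a \o map_poly h); split; first exact: noetherian_poly.
move=> b; rewrite inE => /predU1P[->|/hs[q <-]].
  by exists 'X; rewrite /= map_polyX /horner_eval hornerX.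
by exists q%:P; rewrite /= map_polyC /horner_eval hornerC.
Qed.

(** The colon ideals [K : x^n] form an ascending chain. If it did not stop, each exponent would have
    a witness; the exponents [e n] are spaced so that [x ^+ e n] sends all earlier witnesses into
    [K], and a witness depending on these contradicts its choice. *)
Lemma noetherian_torsion (R : comNzRingType) (K : set R) x :
  noetherian R -> ideal K -> exists e, forall a n, K (x ^+ n * a) -> K (x ^+ e * a).
Proof.
move=> noR [K0 KD KM]; apply: contrapT => N.
have ex_a e : exists an : R * nat, K (x ^+ an.2 * an.1) /\ ~ K (x ^+ e * an.1).
  apply: contrapT => Ne; apply: N; exists e => a n Kan; apply: contrapT => Nea.
  by apply: Ne; exists (a, n).
have [F FP] := choice ex_a.
pose e n := iter n (fun k => k + (F k).2)%N 0%N.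
have eS n : e n.+1 = (e n + (F (e n)).2)%N by [].
have e_le i m : (i <= m)%N -> (e i <= e m)%N.
  move=> /subnK<-; elim: (m - i)%N => [//|k IHk].
  by rewrite addSn eS; apply: leq_trans IHk (leq_addr _ _).
have [m [c am]] := noR (fun i => (F (e i)).1).
have [_ /=] := FP (e m); apply; rewrite am mulr_sumr.
apply: (big_ind K) => // i _; rewrite mulrCA; apply: (KM).
have := e_le _ _ (ltn_ord i); rewrite eS => /subnK <-.
rewrite addnA !exprD -!mulrA; apply: (KM); apply: KM.
by have [] := FP (e i).
Qed.

Section Koszul.
Variable R : comNzRingType.
Implicit Types (x y z a b c : R) (n : nat).

Lemma ideal0 : ideal [set 0 : R].
Proof. by split=> // [a b -> ->|r a ->]; rewrite /= ?addr0 ?mulr0. Qed.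

Lemma ideal_principal x : ideal [set a | exists b, a = x * b].
Proof.
split=> [|a b [c ->] [d ->]|r a [b ->]].
- by exists 0; rewrite mulr0.
- by exists (c + d); rewrite mulrDr.
- by exists (r * b); rewrite mulrCA.
Qed.

Lemma ideal_pair x y : ideal [set a | exists b c, a = x * b + y * c].
Proof.
split=> [|a b [c [d ->]] [c' [d' ->]]|r a [b [c ->]]].
- by exists 0, 0; rewrite !mulr0 addr0.
- by exists (c + c'), (d + d'); ring.
- by exists (r * b), (r * c); ring.
Qed.

(* The transition maps between first Koszul homology modules are eventually 0. *)
Lemma koszul1_pro_zero x y z n : noetherian R ->
  exists e, forall a b c,
    x ^+ (n + e) * a + y ^+ (n + e) * b + z ^+ (n + e) * c = 0 ->
  exists p q r, [/\ x ^+ e * a = y ^+ n * p + z ^+ n * q,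
    y ^+ e * b = - (x ^+ n * p) + z ^+ n * r
    & z ^+ e * c = - (x ^+ n * q) - y ^+ n * r].
Proof.
move=> noR.
(* Three torsion bounds replace regularity: of [x] modulo 0, of [y] modulo a power of [x], of [z]
   modulo powers of [x] and [y]. *)
have [e0 tor0] := noetherian_torsion x noR ideal0.
have [e1 tor1] := noetherian_torsion y noR (ideal_principal (x ^+ (n + e0))).
pose f := (e1 + e0)%N.
have [e2 tor2] := noetherian_torsion z noR (ideal_pair (x ^+ (n + f)) (y ^+ (n + f))).
exists (e2 + f)%N => a b c rel.
have [|al [be cE]] := tor2 c (n + (e2 + f))%N.
  exists (- (x ^+ e2 * a)), (- (y ^+ e2 * b)).
  move/eqP: rel; rewrite addrC addr_eq0 => /eqP->; rewrite !exprD; ring.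
(* Substituting [cE] into the relation absorbs its [z] term into new coefficients [a'] and [b']. *)
pose a' := x ^+ e2 * a + z ^+ (n + f) * al.
pose b' := y ^+ e2 * b + z ^+ (n + f) * be.
have rel' : x ^+ (n + f) * a' + y ^+ (n + f) * b' = 0.
  transitivity (x ^+ (n + (e2 + f)) * a + y ^+ (n + (e2 + f)) * b +
    z ^+ (n + f) * (x ^+ (n + f) * al + y ^+ (n + f) * be)).
    by rewrite /a' /b' !exprD; ring.
  by rewrite -cE -rel !exprD; ring.
have [|ga b'E] := tor1 b' (n + f)%N.
  exists (- (x ^+ e1 * a')).
  by move/eqP: rel'; rewrite addrC addr_eq0 => /eqP->; rewrite /f !exprD; ring.
have a'E : x ^+ e0 * (x ^+ e1 * a' + y ^+ (n + e0) * ga) = 0.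
  apply: (tor0 _ (n + e0)%N) => /=.
  transitivity (x ^+ (n + f) * a' + y ^+ (n + e0) * (x ^+ (n + e0) * ga)).
    by rewrite /f !exprD; ring.
  by rewrite -b'E -rel' /f !exprD; ring.
exists (- (x ^+ e0 * y ^+ e0 * ga)), (- (z ^+ f * x ^+ f * al)), (- (z ^+ f * y ^+ f * be)); split.
- apply/eqP; rewrite -subr_eq0 -[X in _ == X]a'E; apply/eqP.
  by rewrite /a' /f !exprD; ring.
- transitivity (y ^+ e0 * (y ^+ e1 * b') - z ^+ n * (z ^+ f * y ^+ f * be)).
    by rewrite /b' /f !exprD; ring.
  by rewrite b'E /f !exprD; ring.
- transitivity (z ^+ f * (z ^+ e2 * c)); first by rewrite exprD; ring.
  by rewrite cE !exprD; ring.
Qed.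

(** The counterpart for second Koszul homology: a cycle becomes the multiple by [d] of
    [(z^n, -y^n, x^n)]. Torsion of [y] modulo a power of [x] divides [c]; cancelling [x] then
    recovers [a] and [b]. *)
Lemma koszul2_pro_zero x y z n : noetherian R ->
  exists e, forall a b c,
    x ^+ (n + e) * a = z ^+ (n + e) * c ->
    x ^+ (n + e) * b + y ^+ (n + e) * c = 0 ->
  exists d, [/\ (x * y) ^+ e * a = z ^+ n * d,
    (x * z) ^+ e * b = - (y ^+ n * d) & (y * z) ^+ e * c = x ^+ n * d].
Proof.
move=> noR.
have [e0 tor0] := noetherian_torsion x noR ideal0.
have [e1 tor1] := noetherian_torsion y noR (ideal_principal (x ^+ (n + e0))).
exists (e0 + e1)%N => a b c rel1 rel2.
have [|d cE] := tor1 c (n + (e0 + e1))%N.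
  exists (- (x ^+ e1 * b)).
  by move/eqP: rel2; rewrite addrC addr_eq0 => /eqP->; rewrite !exprD; ring.
exists (x ^+ e0 * y ^+ e0 * z ^+ (e0 + e1) * d); split.
- apply/eqP; rewrite -subr_eq0; apply/eqP.
  transitivity (x ^+ e0 * (x ^+ e1 * y ^+ (e0 + e1) * a - z ^+ (n + (e0 + e1)) * y ^+ e0 * d)).
    by rewrite exprMn !exprD; ring.
  apply: (tor0 _ (n + e0)%N) => /=.
  transitivity (y ^+ (e0 + e1) * (x ^+ (n + (e0 + e1)) * a) - z ^+ (n + (e0 + e1)) * y ^+ e0 * (x ^+ (n + e0) * d)).
    by rewrite !exprD; ring.
  by rewrite -cE rel1 !exprD; ring.
- apply/eqP; rewrite -subr_eq0; apply/eqP.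
  transitivity (x ^+ e0 * (x ^+ e1 * z ^+ (e0 + e1) * b + y ^+ (n + e0) * z ^+ (e0 + e1) * d)).
    by rewrite exprMn !exprD; ring.
  apply: (tor0 _ (n + e0)%N) => /=.
  transitivity (z ^+ (e0 + e1) * (x ^+ (n + (e0 + e1)) * b) + y ^+ (n + e0) * z ^+ (e0 + e1) * (x ^+ (n + e0) * d)).
    by rewrite !exprD; ring.
  move/eqP: rel2; rewrite addr_eq0 => /eqP->; rewrite -cE !exprD; ring.
- transitivity (y ^+ e0 * z ^+ (e0 + e1) * (y ^+ e1 * c)); first by rewrite exprMn !exprD; ring.
  by rewrite cE !exprD; ring.
Qed.

End Koszul.

(** * Local cohomology and Koszul cocycles *)

Section Image.
Variables (R : comNzRingType) (F B : lmodType R) (k : {linear F -> B}).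

Definition im_pred : {pred B} := [pred b | `[< exists f, b = k f >]].

Lemma im_pred_closed : subsemimod_closed im_pred.
Proof.
split=> [|r b]; rewrite ?inE; last first.
  by move=> [f ->]; exists (r *: f); rewrite linearZ.
split=> [|b c]; first by rewrite inE; exists 0; rewrite linear0.
by rewrite !inE => -[f ->] [g ->]; exists (f + g); rewrite linearD.
Qed.
HB.instance Definition _ := GRing.isSubSemiModClosed.Build R B im_pred im_pred_closed.

Definition im_preimage (b : submodule im_pred) : F :=
  sval (cid (asboolP _ (valP b))).

Lemma im_preimageK b : k (im_preimage b) = \val b.
Proof. by rewrite /im_preimage; case: cid => f /= ->. Qed.

Variables (E : lmodType R) (g : {linear F -> E}).
Hypothesis ker_sub : forall f, k f = 0 -> g f = 0.

Definition im_factor (b : submodule im_pred) : E := g (im_preimage b).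

Lemma im_factor_eq f b : k f = \val b -> im_factor b = g f.
Proof.
rewrite -im_preimageK => /eqP; rewrite eq_sym -subr_eq0 -linearB => /eqP/ker_sub.
by rewrite linearB => /eqP; rewrite subr_eq0 => /eqP.
Qed.

Lemma im_factor_linear : linear im_factor.
Proof.
move=> r b c; rewrite -[RHS]linearP; apply: im_factor_eq.
by rewrite linearP /= !im_preimageK.
Qed.
HB.instance Definition _ := GRing.isLinear.Build R (submodule im_pred) E _ im_factor im_factor_linear.

(** [injective_module] extends maps along injections only, so [g] is first factored through the
    image of [k]. *)
Lemma injective_lift : injective_module E ->
  exists h : {linear B -> E}, forall f, h (k f) = g f.
Proof.
move=> injE.
have [h hE] := injE (submodule im_pred) B (val : {linear submodule im_pred -> B}) im_factor val_inj.
exists h => f; have kf : k f \in im_pred by rewrite inE; exists f.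
by rewrite -[k f]/(val (Sub (k f) kf : submodule im_pred)) hE; apply: im_factor_eq.
Qed.

End Image.

(** * Linear systems over an injective module *)

Section LinearSystem.
Variables (R : comNzRingType) (E : lmodType R).

Definition row_comb m (b : 'I_m -> E) (a : 'rV[R]_m) : E := \sum_i a 0 i *: b i.

Lemma row_comb_linear m (b : 'I_m -> E) : linear (row_comb b).
Proof.
move=> r u v; rewrite /row_comb scaler_sumr -big_split /=.
by apply: eq_bigr => i _; rewrite !mxE scalerDl scalerA.
Qed.
HB.instance Definition _ m (b : 'I_m -> E) :=
  GRing.isLinear.Build R 'rV[R]_m E _ (row_comb b) (row_comb_linear b).

(** The relations among the rows of [M] are respected by [b], which thus defines a map on the row
    space; extended to the free module, its values on the basis solve the system. *)
Lemma injective_solve m n (M : 'M[R]_(m, n)) (b : 'I_m -> E) : injective_module E ->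
    (forall a : 'rV_m, a *m M = 0 -> row_comb b a = 0) ->
  exists v : 'I_n -> E, forall i, \sum_j M i j *: v j = b i.
Proof.
move=> injE kb; have [h hE] := injective_lift (k := mulmxr M) (g := row_comb b) kb injE.
exists (fun j => h (delta_mx 0 j)) => i.
transitivity (h (row i M)).
  rewrite [row i M]row_sum_delta linear_sum; apply: eq_bigr => j _.
  by rewrite linearZ /= mxE.
rewrite rowE; have /= -> := hE (delta_mx 0 i).
rewrite /row_comb (bigD1 i) //= mxE !eqxx scale1r big1 ?addr0 // => j /negbTE ji.
by rewrite mxE ji andbF scale0r.
Qed.

Let seq3 (T : Type) (a b c : T) (i : 'I_3) := nth a [:: a; b; c] i.

Lemma injective_solve1 (x y z : R) (v0 v1 v2 : E) : injective_module E ->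
    (forall a b c, a * x + b * y + c * z = 0 -> a *: v0 + b *: v1 + c *: v2 = 0) ->
  exists v, [/\ x *: v = v0, y *: v = v1 & z *: v = v2].
Proof.
move=> injE rel.
have [|v vE] := @injective_solve 3 1 (\col_i seq3 x y z i) (seq3 v0 v1 v2) injE.
  move=> a /matrixP/(_ 0 0); rewrite !mxE /row_comb !big_ord_recl !big_ord0 !mxE /=.
  by rewrite !addr0 !addrA => /rel.
exists (v 0); have := vE 0; have := vE 1; have := vE 2%:R.
by rewrite !big_ord_recl !big_ord0 !addr0 !mxE.
Qed.

Lemma injective_solve_koszul (x y z : R) (r01 r02 r12 : E) : injective_module E ->
    (forall a b c, y * a + z * b = 0 -> x * a = z * c -> x * b + y * c = 0 ->
      a *: r01 + b *: r02 + c *: r12 = 0) ->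
  exists v0 v1 v2, [/\ y *: v0 - x *: v1 = r01, z *: v0 - x *: v2 = r02
    & z *: v1 - y *: v2 = r12].
Proof.
move=> injE rel.
pose M : 'M[R]_(3, 3) := \matrix_(i, j)
  seq3 (seq3 y (- x) 0 j) (seq3 z 0 (- x) j) (seq3 0 z (- y) j) i.
have [|v vE] := @injective_solve 3 3 M (seq3 r01 r02 r12) injE.
  move=> a /matrixP aM.
  have := aM 0 0; have := aM 0 1; have := aM 0 2%:R.
  rewrite !mxE /row_comb !big_ord_recl !big_ord0 !mxE /= !addr0 !addrA.
  rewrite !mulr0 !mulrN !addr0 !add0r => h2 h1 h0; apply: rel.
  - by rewrite mulrC [z * _]mulrC.
  - by rewrite mulrC [z * _]mulrC; apply/eqP; rewrite -subr_eq0 -oppr_eq0 opprB addrC h1.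
  - by rewrite mulrC [y * _]mulrC; apply/eqP; rewrite -oppr_eq0 opprD h2.
exists (v 0), (v 1), (v 2%:R); have := vE 0; have := vE 1; have := vE 2%:R.
rewrite !big_ord_recl !big_ord0 !addr0 !mxE /= !scaleNr !scale0r !add0r.
have -> : lift ord0 (lift ord0 ord0) = 2%:R :> 'I_3 by apply: val_inj.
have -> : lift ord0 ord0 = 1 :> 'I_3 by apply: val_inj.
rewrite !addr0 => h2 h1 h0.
by split; [exact: h0|exact: h1|exact: h2].
Qed.

End LinearSystem.

Section PowerTorsion.
Variables (R : comNzRingType) (x y z : R).

Definition power_torsion (M : lmodType R) n (m : M) : Prop :=
  [/\ x ^+ n *: m = 0, y ^+ n *: m = 0 & z ^+ n *: m = 0].

Let J := ideal_gen [set x; y; z].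

Lemma ideal_gen3P a : J a -> exists b c d, a = b * x + c * y + d * z.
Proof.
pose K := [set a | exists b c d, a = b * x + c * y + d * z].
apply: (@ideal_gen_sub _ _ K) => [|_ [[->|->]|->]].
- split=> [|a1 a2 [b [c [d ->]]] [b' [c' [d' ->]]]|r a1 [b [c [d ->]]]].
  + by exists 0, 0, 0; rewrite !mul0r !addr0.
  + by exists (b + b'), (c + c'), (d + d'); ring.
  + by exists (r * b), (r * c), (r * d); ring.
- by exists 1, 0, 0; ring.
- by exists 0, 1, 0; ring.
- by exists 0, 0, 1; ring.
Qed.

Lemma ideal_pow_exp (K : set R) a n : K a -> ideal_pow K n (a ^+ n).
Proof.
move=> Ka; elim: n => [//|n IHn]; rewrite exprS.
by apply: sub_ideal_gen; exists a => //; exists (a ^+ n).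
Qed.

(** Multiplying [m] by a generator of [J] lowers one of the three exponents, so induction on their
    sum applies. *)
Lemma ideal_pow_kills (M : lmodType R) (m : M) i j k :
  x ^+ i *: m = 0 -> y ^+ j *: m = 0 -> z ^+ k *: m = 0 ->
  forall a, ideal_pow J (i + j + k) a -> a *: m = 0.
Proof.
move: {2}(i + j + k)%N (leqnn (i + j + k)) => s; elim: s => [|s IHs] in m i j k *.
  rewrite leqn0 !addn_eq0 => /andP[/andP[/eqP-> _] _].
  by rewrite expr0 scale1r => -> *; rewrite scaler0.
move=> le_s xm ym zm a; have [z0|zN0] := eqVneq m 0; first by rewrite z0 scaler0.
case: i => [|i] in xm le_s *; first by case/eqP: zN0; rewrite -xm expr0 scale1r.
case: j => [|j] in ym le_s *; first by case/eqP: zN0; rewrite -ym expr0 scale1r.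
case: k => [|k] in zm le_s *; first by case/eqP: zN0; rewrite -zm expr0 scale1r.
pose n := (i + j + k).+2.
have -> : (i.+1 + j.+1 + k.+1)%N = n.+1 by rewrite /n; lia.
have zr1 (u v : R) : u *: (v *: m) = v *: (u *: m) by rewrite !scalerA mulrC.
have sn : (i + j + k + 2 <= s)%N by move: le_s; rewrite !addSn !addnS; lia.
have xk b : ideal_pow J n b -> b *: (x *: m) = 0.
  have -> : n = (i + j.+1 + k.+1)%N by rewrite /n; lia.
  apply: IHs; [by lia|by rewrite scalerA -exprSr xm| |].
  - by rewrite zr1 ym scaler0.
  - by rewrite zr1 zm scaler0.
have yk b : ideal_pow J n b -> b *: (y *: m) = 0.
  have -> : n = (i.+1 + j + k.+1)%N by rewrite /n; lia.
  apply: IHs; [by lia| |by rewrite scalerA -exprSr ym|].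
  - by rewrite zr1 xm scaler0.
  - by rewrite zr1 zm scaler0.
have zk b : ideal_pow J n b -> b *: (z *: m) = 0.
  have -> : n = (i.+1 + j.+1 + k)%N by rewrite /n; lia.
  apply: IHs; [by lia| | |by rewrite scalerA -exprSr zm].
  - by rewrite zr1 xm scaler0.
  - by rewrite zr1 ym scaler0.
have idK : ideal [set a | a *: m = 0].
  split=> [|b c /= bm cm|r b /= bm]; rewrite /= ?scale0r // ?scalerDl ?bm ?cm ?addr0 //.
  by rewrite -scalerA bm scaler0.
apply: (ideal_gen_sub idK) => _ [_ /ideal_gen3P[b [c [d ->]]] [e Je <-]] /=.
have -> : (b * x + c * y + d * z) * e = b * (e * x) + c * (e * y) + d * (e * z) by ring.
by rewrite !scalerDl -!scalerA xk // yk // zk // !scaler0 !addr0.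
Qed.

Lemma torsionP (M : lmodType R) (m : M) :
  m \in torsion_pred J (M := M) <-> exists n, power_torsion n m.
Proof.
split; rewrite inE.
  move=> [n Jn]; exists n; split; apply: Jn; apply: ideal_pow_exp.
  - by apply: sub_ideal_gen; left; left.
  - by apply: sub_ideal_gen; left; right.
  - by apply: sub_ideal_gen; right.
by move=> [n [xn yn zn]]; exists (n + n + n)%N; apply: ideal_pow_kills.
Qed.

End PowerTorsion.

(** * Annihilators of classes in the second local cohomology *)

Section SecondCohomology.
Variables (R : comNzRingType) (x y z : R) (M : lmodType R) (I : injective_resolution M).
Let J := ideal_gen [set x; y; z].
Local Notation d := (cdiff I _).
Local Notation H2 := (local_cohomology J I 2).
Local Open Scope quotient_scope.

(* The annihilator of a class of [H^2_J], in terms of a primitive [w] in [I^1]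
   of a cocycle representing it. *)
Definition class_of (zeta : H2) (w : I 1%N) : Prop :=
  (exists n, power_torsion x y z n (d w)) /\
  forall g : R, g *: zeta = 0 <->
    exists t, (exists n, power_torsion x y z n t) /\ d t = g *: d w.

Lemma class_of_cocycle (c : cocycles (torsion_complex J I) 2) w :
  d w = \val (\val c) -> class_of (\pi c : H2) w.
Proof.
move=> dw; split; first by rewrite dw; apply/torsionP/(valP (\val c)).
move=> g; rewrite -[g *: \pi_H2 c](pi_scale (cobound_pred (C := torsion_complex J I) (i := 2)) g c).
rewrite (_ : (_ = 0) <-> (g *: c \in @cobound_pred _ (torsion_complex J I) 2)).
  rewrite inE; split=> [[b bE]|[t [tt dt]]].
    exists (\val b); split; first by apply/torsionP/(valP b).
    by have := congr1 val bE; rewrite /= dw => <-.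
  move/torsionP: tt => tt; exists (Sub t tt); apply: val_inj.
  by rewrite /= dt dw.
rewrite -[X in _ = X](raddf0 \pi_H2); split.
  by move/eqP; rewrite -Quotient.idealrBE subr0.
by move=> gc; apply/eqP; rewrite -Quotient.idealrBE subr0.
Qed.

Lemma class_of_surj (zeta : H2) : exists w, class_of zeta w.
Proof.
have /eqP cz := valP (repr zeta).
have [|w wE] := @res_exact _ _ I 1 (\val (\val (repr zeta))).
  by have := congr1 val cz.
by exists w; rewrite -[zeta]reprK; apply: class_of_cocycle.
Qed.

Lemma class_of_exists n w : power_torsion x y z n (d w) -> exists zeta : H2, class_of zeta w.
Proof.
move=> tw; have tor : d w \in torsion_pred J (M := I 2).
  by apply/torsionP; exists n.
pose zt : torsion J (I 2) := Sub (d w) tor.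
have cz : zt \in ker_pred (cdiff (torsion_complex J I) 2).
  by rewrite inE; apply/eqP; apply: val_inj; rewrite /= cdiffK.
pose zc : submodule (ker_pred (cdiff (torsion_complex J I) 2)) := Sub zt cz.
by exists (\pi_H2 zc); apply: class_of_cocycle.
Qed.

End SecondCohomology.

Section KoszulClass.
Variables (R : comNzRingType) (x y z : R).
Implicit Types (n m : nat) (a b c g : R).

(** The Cech condition on [(a / (xy)^n, b / (xz)^n, c / (yz)^n)], multiplied by [(xyz)^n] and
    imposed in [R] itself. *)
Definition koszul_cocycle n a b c : Prop := z ^+ n * a - y ^+ n * b + x ^+ n * c = 0.

Definition koszul_coboundary n a b c : Prop := exists s0 s1 s2,
  [/\ a = y ^+ n * s0 - x ^+ n * s1, b = z ^+ n * s0 - x ^+ n * s2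
    & c = z ^+ n * s1 - y ^+ n * s2].

(* The fraction [(a / (xy)^n, b / (xz)^n, c / (yz)^n)] is a Cech coboundary. *)
Definition cech_trivial n a b c : Prop := exists m,
  koszul_coboundary (n + m) ((x * y) ^+ m * a) ((x * z) ^+ m * b) ((y * z) ^+ m * c).

(** The obstruction to solving for [v] in an injective module is dual to first Koszul homology,
    which dies after raising exponents. *)
Lemma injective_divide N : noetherian R -> exists e, forall (E : lmodType R) (v0 v1 v2 : E),
    injective_module E -> y ^+ N *: v0 = x ^+ N *: v1 -> z ^+ N *: v0 = x ^+ N *: v2 ->
    z ^+ N *: v1 = y ^+ N *: v2 ->
  exists v, [/\ x ^+ (N + e) *: v = x ^+ e *: v0, y ^+ (N + e) *: v = y ^+ e *: v1
    & z ^+ (N + e) *: v = z ^+ e *: v2].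
Proof.
move=> noR; have [e ker1] := koszul1_pro_zero x y z N noR.
exists e => E v0 v1 v2 injE c01 c02 c12; apply: injective_solve1 => // p q r.
rewrite (mulrC p) (mulrC q) (mulrC r) => /ker1[i [j [k [pE qE rE]]]].
rewrite !scalerA (mulrC p) (mulrC q) (mulrC r) pE qE rE.
rewrite !scalerDl !scaleNr (mulrC _ i) (mulrC _ j) (mulrC _ k) (mulrC _ i) (mulrC _ j) (mulrC _ k).
by rewrite -!scalerA c01 c02 c12 addrACA !addrK subrr.
Qed.

Variable I : injective_resolution R^o.
Let J := ideal_gen [set x; y; z].
Local Notation d := (cdiff I _).
Local Notation aug := (res_aug I).
Local Notation H2 := (local_cohomology J I 2).

Let augZ g (r : R) : aug (g * r) = g *: aug r.
Proof. exact: (linearZ_LR aug g (r : R^o)). Qed.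

Let augB (r s : R) : aug (r - s) = aug r - aug s.
Proof. exact: (linearB aug (r : R^o) s). Qed.

Let scaleCA (V : lmodType R) g a (v : V) : g *: (a *: v) = a *: (g *: v).
Proof. by rewrite !scalerA mulrC. Qed.

Let lift_cochain (v : I 0%N) : d v = 0 -> exists r : R, aug r = v.
Proof. by move/res_exact0 => [r ->]; exists r. Qed.

Let lift_cocycle g (w : I 1%N) : g *: d w = 0 -> exists v, d v = g *: w.
Proof. by rewrite -linearZ /= => /res_exact[v ->]; exists v. Qed.

Let dZ i g (v : I i) : d (g *: v) = g *: d v. Proof. exact: linearZ. Qed.
Let dB i (u v : I i) : d (u - v) = d u - d v. Proof. exact: linearB. Qed.

(** Powers of [x], [y], [z] send [w] to cocycles, which lift to [I^0]; the cross differences of the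
    lifts come from [R] and form the Koszul cocycle. A trivialisation of its multiple by [g] makes
    the lifts, up to powers, multiples of a single [v], and [g *: w - d v] is then a torsion
    primitive of [g *: d w]. *)
Lemma class_koszul (zeta : H2) : noetherian R ->
  exists n a b c, koszul_cocycle n a b c /\
    forall g, cech_trivial n (g * a) (g * b) (g * c) -> g *: zeta = 0.
Proof.
move=> noR; have [w [[n [xw yw zw]] kill]] := class_of_surj zeta.
have [v0 dv0] := lift_cocycle xw.
have [v1 dv1] := lift_cocycle yw.
have [v2 dv2] := lift_cocycle zw.
have [|a aE] := @lift_cochain (y ^+ n *: v0 - x ^+ n *: v1).
  by rewrite dB !dZ dv0 dv1 scaleCA subrr.
have [|b bE] := @lift_cochain (z ^+ n *: v0 - x ^+ n *: v2).
  by rewrite dB !dZ dv0 dv2 scaleCA subrr.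
have [|c cE] := @lift_cochain (z ^+ n *: v1 - y ^+ n *: v2).
  by rewrite dB !dZ dv1 dv2 scaleCA subrr.
exists n, a, b, c; split.
  apply: (@res_aug_inj _ _ I); rewrite linearD augB !augZ aE bE cE linear0.
  rewrite !scalerBr (scaleCA (z ^+ n) (y ^+ n)) (scaleCA (z ^+ n) (x ^+ n)) (scaleCA (y ^+ n) (x ^+ n)).
  by rewrite opprB [X in X + _]addrC !subrKA subrr.
move=> g [m [s0 [s1 [s2 [aS bS cS]]]]]; apply/kill.
pose N := (n + m)%N; rewrite -/N in aS bS cS.
(* Lifts of the multiples of [g *: w] by [x ^+ N], [y ^+ N], [z ^+ N], corrected by the
   trivialisation so as to become compatible. *)
pose v'0 := (g * x ^+ m) *: v0 - aug s0.
pose v'1 := (g * y ^+ m) *: v1 - aug s1.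
pose v'2 := (g * z ^+ m) *: v2 - aug s2.
have comp (p q : R) (u v : I 0%N) (s t r : R) :
    aug r = q ^+ n *: u - p ^+ n *: v -> (p * q) ^+ m * (g * r) = q ^+ N * s - p ^+ N * t ->
    q ^+ N *: ((g * p ^+ m) *: u - aug s) = p ^+ N *: ((g * q ^+ m) *: v - aug t).
  move=> rE rS; have : aug (q ^+ N * s - p ^+ N * t) = (p * q) ^+ m * g *: (q ^+ n *: u - p ^+ n *: v).
    by rewrite -rS mulrA augZ rE.
  rewrite augB !augZ => autE; apply/eqP; rewrite -subr_eq0 !scalerBr opprD opprK addrACA.
  rewrite [- (_ *: aug s) + _]addrC -(opprB (q ^+ N *: aug s)) autE scalerBr !scalerA subr_eq0 !exprD exprMn.
  apply/eqP; congr (_ *: _ - _ *: _); ring.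

have c01 : y ^+ N *: v'0 = x ^+ N *: v'1 by exact: comp aE aS.
have c02 : z ^+ N *: v'0 = x ^+ N *: v'2 by exact: comp bE bS.
have c12 : z ^+ N *: v'1 = y ^+ N *: v'2 by exact: comp cE cS.
have daug r : d (aug r) = 0 by apply/res_exact0; exists r.
have dv' p (u : I 0%N) s : d u = p ^+ n *: w -> d ((g * p ^+ m) *: u - aug s) = p ^+ N *: (g *: w).
  move=> du; rewrite dB daug subr0 dZ du !scalerA /N exprD; congr (_ *: _).
  by ring.
have [e /(_ _ v'0 v'1 v'2 (@res_inj _ _ I 0%N) c01 c02 c12)[v [xv yv zv]]] := injective_divide N noR.
exists (g *: w - d v); split; last first.
  by rewrite dB dZ cdiffK subr0.
have tor p (u : I 0%N) : p ^+ (N + e) *: v = p ^+ e *: u -> d u = p ^+ N *: (g *: w) ->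
    p ^+ (N + e) *: (g *: w - d v) = 0.
  move=> pv du; rewrite scalerBr -dZ pv dZ du !scalerA exprD.
  by rewrite (mulrC (p ^+ N)) subrr.
exists (N + e)%N; split.
- by apply: tor xv _; apply: dv'.
- by apply: tor yv _; apply: dv'.
- by apply: tor zv _; apply: dv'.
Qed.

(** The chase is run backwards: injectivity of [I^0] yields elements with the prescribed cross
    differences, the obstruction being second Koszul homology; injectivity of [I^1] then yields [w]
    from their differentials, the obstruction being first Koszul homology. *)
Lemma koszul_class n a b c : noetherian R -> koszul_cocycle n a b c ->
  exists zeta : H2, forall g, g *: zeta = 0 -> cech_trivial n (g * a) (g * b) (g * c).
Proof.
move=> noR cocyc; have [e ker2] := koszul2_pro_zero x y z n noR.
pose N := (n + e)%N.
have [v0 [v1 [v2 [aE bE cE]]]] : exists v0 v1 v2 : I 0%N,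
    [/\ y ^+ N *: v0 - x ^+ N *: v1 = aug ((x * y) ^+ e * a),
        z ^+ N *: v0 - x ^+ N *: v2 = aug ((x * z) ^+ e * b)
      & z ^+ N *: v1 - y ^+ N *: v2 = aug ((y * z) ^+ e * c)].
  apply: injective_solve_koszul (@res_inj _ _ I 0%N) _ => p q r _ pr qr.
  have [f [pE qE rE]] := ker2 _ _ _ pr qr.
  have augD (s t : R) : aug (s + t) = aug s + aug t by exact: (linearD aug (s : R^o) t).
  rewrite -!augZ -!augD -[RHS](linear0 aug); congr (aug _).
  transitivity (f * (z ^+ n * a - y ^+ n * b + x ^+ n * c)); last by rewrite cocyc mulr0.
  rewrite !mulrA (mulrC p) (mulrC q) (mulrC r) pE qE rE; ring.
have daug (r : R) : d (aug r) = 0 by apply/res_exact0; exists r.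
have dvE p q (u v : I 0%N) r : q *: u - p *: v = aug r -> q *: d u = p *: d v.
  by move=> /(congr1 (fun t => d t)); rewrite dB !dZ daug => /eqP; rewrite subr_eq0 => /eqP.
have [f /(_ _ _ _ _ (@res_inj _ _ I 1%N) (dvE _ _ _ _ _ aE) (dvE _ _ _ _ _ bE) (dvE _ _ _ _ _ cE))] :=
  injective_divide N noR.
move=> [w [xw yw zw]].
have [|zeta [_ kill]] := @class_of_exists _ x y z _ I (N + f) w.
  by split; rewrite -dZ ?xw ?yw ?zw dZ cdiffK scaler0.
exists zeta => g /kill[t [[k [xt yt zt]] dt]].
(* Both [g *: w] and the torsion element [t] are primitives of [g *: d w]. *)
have [u uE] : exists u, g *: w - t = d u by apply: res_exact; rewrite dB dZ dt subrr.
have lift p v : p ^+ (N + f) *: w = p ^+ f *: d v -> p ^+ k *: t = 0 ->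
    exists s : R, aug s = (g * p ^+ (k + f)) *: v - p ^+ (N + f + k) *: u.
  move=> pw pt; apply: lift_cochain; rewrite dB !dZ -uE scalerBr.
  rewrite [p ^+ (N + f + k)]exprD -[(_ * _) *: t]scalerA pt scaler0 subr0.
  rewrite (mulrC (p ^+ (N + f))) -!scalerA (scaleCA _ g) pw (scaleCA _ g) exprD -scalerA.
  by rewrite subrr.
have [s0 s0E] := lift _ _ xw xt.
have [s1 s1E] := lift _ _ yw yt.
have [s2 s2E] := lift _ _ zw zt.
exists (e + (f + k))%N, s0, s1, s2.
have comp p q (s s' r : R) (v v' : I 0%N) : q ^+ N *: v - p ^+ N *: v' = aug ((p * q) ^+ e * r) ->
    aug s = (g * p ^+ (k + f)) *: v - p ^+ (N + f + k) *: u ->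
    aug s' = (g * q ^+ (k + f)) *: v' - q ^+ (N + f + k) *: u ->
    (p * q) ^+ (e + (f + k)) * (g * r) = q ^+ (n + (e + (f + k))) * s - p ^+ (n + (e + (f + k))) * s'.
  move=> rE sE s'E; apply: (@res_aug_inj _ _ I).
  have -> : (p * q) ^+ (e + (f + k)) * (g * r) = (g * (p * q) ^+ (k + f)) * ((p * q) ^+ e * r).
    by rewrite !exprD; ring.
  rewrite augZ -rE augB !augZ sE s'E !scalerBr !scalerA.
  rewrite -/N in rE *; rewrite opprD opprK addrACA.
  rewrite (_ : q ^+ (n + (e + (f + k))) = q ^+ (N + f + k)); last by rewrite /N !addnA.
  rewrite (_ : p ^+ (n + (e + (f + k))) = p ^+ (N + f + k)); last by rewrite /N !addnA.
  rewrite (mulrC (p ^+ (N + f + k)) (q ^+ _)) addNr addr0 !exprD !exprMn.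
  by congr (_ *: _ - _ *: _); ring.
split; [exact: comp aE s0E s1E|exact: comp bE s0E s2E|exact: comp cE s1E s2E].
Qed.

End KoszulClass.

(** * Division by monomials *)

Section DivisionOperators.
Variables (S : comNzRingType) (I : eqType) (x : I -> S) (D : I -> nat -> S -> S).
Hypothesis DB : forall i n, {morph D i n : f g / f - g}.
Hypothesis DxM : forall i n f, D i n (x i ^+ n * f) = f.
Hypothesis DxM_neq : forall i j n l f, i != j -> D i n (x j ^+ l * f) = x j ^+ l * D i n f.

Lemma xpow_inj i n f g : x i ^+ n * f = x i ^+ n * g -> f = g.
Proof. by move/(congr1 (D i n)); rewrite !DxM. Qed.

(** [D i n] commutes with powers of the other variables; applied to the equation it shows that [g]
    is divisible. This stands in for regularity of the pair [x i], [x j]. *)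
Lemma xpow_proportional i j n f g : i != j -> x j ^+ n * f = x i ^+ n * g ->
  exists h, f = x i ^+ n * h /\ g = x j ^+ n * h.
Proof.
move=> ij fg; exists (D i n f).
have gE : g = x j ^+ n * D i n f by rewrite -DxM_neq // fg DxM.
by split=> //; apply: (@xpow_inj j n); rewrite fg {1}gE mulrCA.
Qed.

(** Exactness of the Koszul complex: dividing the relation by [x l ^+ n] gives [s0] and [s1], and
    what they leave of [b] and [c] is proportional. *)
Lemma xpow_cocycle i j l n a b c : i != j -> i != l -> j != l ->
  x l ^+ n * a - x j ^+ n * b + x i ^+ n * c = 0 ->
  exists s0 s1 s2, [/\ a = x j ^+ n * s0 - x i ^+ n * s1,
    b = x l ^+ n * s0 - x i ^+ n * s2 & c = x l ^+ n * s1 - x j ^+ n * s2].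
Proof.
move=> ij il jl rel.
have {}rel : x l ^+ n * a = x j ^+ n * b - x i ^+ n * c.
  by apply/eqP; rewrite -subr_eq0 opprB addrA addrAC rel.
have aE : a = x j ^+ n * D l n b - x i ^+ n * D l n c.
  by rewrite -[LHS](DxM l n) rel DB !DxM_neq // eq_sym.
set s0 := D l n b in aE; set s1 := D l n c in aE.
have [|s2 [bE cE]] := @xpow_proportional i j n (b - x l ^+ n * s0) (c - x l ^+ n * s1) ij.
  apply/eqP; rewrite -subr_eq0; apply/eqP.
  transitivity (x j ^+ n * b - x i ^+ n * c - x l ^+ n * (x j ^+ n * s0 - x i ^+ n * s1)).
    by ring.
  by rewrite -aE rel subrr.
exists s0, s1, (- s2); split=> //; rewrite mulrN opprK.
  by rewrite -bE addrC subrK.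
by rewrite -cE addrC subrK.
Qed.

End DivisionOperators.

Section MonomialQuotient.
Variables (k : nat) (R : comNzRingType).
Implicit Types (p q : {mpoly R[k]}) (i j : 'I_k) (n : nat).

(* The [R]-linear map sending a monomial to its quotient by ['X_i ^+ n], or to
   [0] when it is not divisible. *)
Definition mdrop i n p : {mpoly R[k]} :=
  \sum_(m : 'X_{1..k < msize p}) p@_(m + U_(i) *+ n)%MM *: 'X_[m].

Lemma mcoeff_mdrop i n p m : (mdrop i n p)@_m = p@_(m + U_(i) *+ n)%MM.
Proof.
have [lt_mp|le_pm] := ltnP (mdeg m) (msize p).
  by rewrite (mcoeff_mpoly (fun m => p@_(m + U_(i) *+ n)%MM)).
rewrite [RHS]memN_msupp_eq0; last first.
  by apply: msize_mdeg_ge; rewrite mdegD (leq_trans le_pm) ?leq_addr.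
rewrite raddf_sum big1 // => m' _; rewrite /= mcoeffZ mcoeffX.
case: eqP => [m'E|_]; last by rewrite mulr0.
by have := bmdeg m'; rewrite m'E ltnNge le_pm.
Qed.

Lemma mcoeff_XnM i n p m :
  ('X_i ^+ n * p)@_m = if (n <= m i)%N then p@_(m - U_(i) *+ n)%MM else 0.
Proof.
have XnU : (U_(i) *+ n <= m)%MM = (n <= m i)%N.
  apply/mnm_lepP/idP => [/(_ i)|le_nm j]; first by rewrite mulmnE mnm1E eqxx mul1n.
  by rewrite mulmnE mnm1E; case: eqP => [<-|]; rewrite ?mul1n ?mul0n.
rewrite mpolyXn mulrC -XnU; case: ifP => [le_Um|nle_Um].
  by rewrite -{1}(submK le_Um) addmC mcoeffMX.
rewrite memN_msupp_eq0 // (perm_mem (msuppMX _ _)); apply/mapP => -[m' _ mE].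
by rewrite mE lem_addr in nle_Um.
Qed.

Lemma mdrop_XnM i n p : mdrop i n ('X_i ^+ n * p) = p.
Proof.
apply/mpolyP => m; rewrite mcoeff_mdrop mcoeff_XnM mnmDE mulmnE mnm1E eqxx mul1n.
by rewrite leq_addl addmK.
Qed.

Lemma mdrop_XnM_neq i j n l p : i != j ->
  mdrop i n ('X_j ^+ l * p) = 'X_j ^+ l * mdrop i n p.
Proof.
move=> ij; apply/mpolyP => m; rewrite mcoeff_mdrop !mcoeff_XnM mcoeff_mdrop.
rewrite mnmDE mulmnE mnm1E (negbTE ij) addn0; case: ifP => // le_lm.
congr (_@__); apply/mnmP => h; rewrite !(mnmBE, mnmDE, mulmnE, mnm1E).
have [jh|jh] := eqVneq j h; last by rewrite !subn0.
by rewrite -jh (negbTE ij) !mul1n !addn0.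
Qed.

Lemma mdropB i n : {morph mdrop i n : p q / p - q}.
Proof. by move=> p q; apply/mpolyP => m; rewrite mcoeffB !mcoeff_mdrop mcoeffB. Qed.

Lemma mdrop0 i n : mdrop i n 0 = 0.
Proof. by apply/mpolyP => m; rewrite mcoeff_mdrop !mcoeff0. Qed.

Local Notation P := {poly {mpoly R[k]}}.
Definition xP i : P := ('X_i : {mpoly R[k]})%:P.

Definition pdrop i n : P -> P := map_poly (mdrop i n).

Lemma pdropB i n : {morph pdrop i n : f g / f - g}.
Proof. by move=> f g; apply/polyP=> l; rewrite coefB !coef_map_id0 ?mdrop0 // coefB mdropB. Qed.

Lemma pdrop_XnM i n f : pdrop i n (xP i ^+ n * f) = f.
Proof.
by apply/polyP => l; rewrite coef_map_id0 ?mdrop0 // /xP -polyC_exp coefCM mdrop_XnM.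
Qed.

Lemma pdrop_XnM_neq i j n l f : i != j -> pdrop i n (xP j ^+ l * f) = xP j ^+ l * pdrop i n f.
Proof.
move=> ij; apply/polyP => h; rewrite /xP -polyC_exp coefCM !coef_map_id0 ?mdrop0 //.
by rewrite coefCM mdrop_XnM_neq.
Qed.

End MonomialQuotient.

(** * First-order thickenings *)

Section CechTrivial.
Variables (R : comNzRingType) (x y z : R).
Implicit Types (n m : nat) (a b c g : R).

Lemma cech_trivial_shift n m a b c s0 s1 s2 :
  cech_trivial x y z (n + m)
    ((x * y) ^+ m * a - (y ^+ (n + m) * s0 - x ^+ (n + m) * s1))
    ((x * z) ^+ m * b - (z ^+ (n + m) * s0 - x ^+ (n + m) * s2))
    ((y * z) ^+ m * c - (z ^+ (n + m) * s1 - y ^+ (n + m) * s2)) ->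
  cech_trivial x y z n a b c.
Proof.
move=> [k [u0 [u1 [u2 [aE bE cE]]]]].
exists (m + k)%N, (u0 + x ^+ k * s0), (u1 + y ^+ k * s1), (u2 + z ^+ k * s2).
have shift (p q r s s' u u' : R) :
    (p * q) ^+ k * ((p * q) ^+ m * r - (q ^+ (n + m) * s - p ^+ (n + m) * s')) =
      q ^+ (n + m + k) * u - p ^+ (n + m + k) * u' ->
    (p * q) ^+ (m + k) * r =
      q ^+ (n + (m + k)) * (u + p ^+ k * s) - p ^+ (n + (m + k)) * (u' + q ^+ k * s').
  rewrite mulrBr => /eqP; rewrite subr_eq => /eqP uE.
  transitivity ((p * q) ^+ k * ((p * q) ^+ m * r)); first by rewrite exprD; ring.
  by rewrite uE !exprD !exprMn; ring.
by split; [apply: shift aE|apply: shift bE|apply: shift cE].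
Qed.

Lemma koszul_cocycle_shift n m a b c s0 s1 s2 : koszul_cocycle x y z n a b c ->
  koszul_cocycle x y z (n + m)
    ((x * y) ^+ m * a - (y ^+ (n + m) * s0 - x ^+ (n + m) * s1))
    ((x * z) ^+ m * b - (z ^+ (n + m) * s0 - x ^+ (n + m) * s2))
    ((y * z) ^+ m * c - (z ^+ (n + m) * s1 - y ^+ (n + m) * s2)).
Proof.
move=> rel; transitivity ((x * y * z) ^+ m * (z ^+ n * a - y ^+ n * b + x ^+ n * c)).
  by rewrite !exprD !exprMn; ring.
by rewrite rel mulr0.
Qed.

Lemma cech_trivial_torsion n e a b c :
  x ^+ e * a = 0 -> x ^+ e * b = 0 -> y ^+ e * c = 0 -> cech_trivial x y z n a b c.
Proof.
move=> a0 b0 c0; exists e, 0, 0, 0; rewrite !mulr0 subrr !exprMn.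
by split; rewrite mulrAC ?a0 ?b0 ?c0 mul0r.
Qed.

End CechTrivial.

Section FirstOrderThickening.
(** An abstract chart: [phi] restricts to the reduced locus [u = t x], [psi l] is the derivative in
    [u_l] followed by [phi], [del] is [d/dt] with chain rule [del_phi], and [eps] sets [x = 0]. By
    [lift_phi] and [ker_phi_psi], once some [X i] is inverted, [phi] is onto and [phi] with the
    [psi l] separates elements. *)
Variables (R P : comNzRingType) (X U : 'I_3 -> R) (x : 'I_3 -> P) (t : P).
Variables (phi : {rmorphism R -> P}) (psi : 'I_3 -> R -> P).
Hypotheses (phiX : forall i, phi (X i) = x i) (phiU : forall i, phi (U i) = x i * t).
Hypotheses (psiX : forall l i, psi l (X i) = 0) (psiU : forall l i, psi l (U i) = (l == i)%:R).
Hypothesis psiD : forall l, {morph psi l : a b / a + b}.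
Hypothesis psiM : forall l a b, psi l (a * b) = psi l a * phi b + phi a * psi l b.

Variable D : 'I_3 -> nat -> P -> P.
Hypothesis DB : forall i n, {morph D i n : f g / f - g}.
Hypothesis DxM : forall i n f, D i n (x i ^+ n * f) = f.
Hypothesis DxM_neq : forall i j n l f, i != j -> D i n (x j ^+ l * f) = x j ^+ l * D i n f.

Variable del : P -> P.
Hypothesis del_xM : forall i f, del (x i * f) = x i * del f.
Hypothesis del_phi : forall a, del (phi a) = \sum_l x l * psi l a.

Variables (eps : {rmorphism P -> {poly int}}) (eta : {poly int} -> P).
Hypotheses (eps_x : forall i, eps (x i) = 0) (eps_t : eps t = 'X).
Hypothesis eps_eta : forall f, eps (eta f) = f.
Hypothesis eps_del : forall f, eps (del f) = (eps f)^`().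
Hypothesis eps_ker : forall f, eps f = 0 -> exists h, f = \sum_l x l * h l.

Hypothesis lift_phi : forall i f, exists m a, phi a = x i ^+ m * f.
Hypothesis ker_phi_psi : forall i a, phi a = 0 -> (forall l, psi l a = 0) ->
  exists m, X i ^+ m * a = 0.

Let psi0 l : psi l 0 = 0.
Proof. by apply: (addIr (psi l 0)); rewrite -psiD !add0r. Qed.

Let psiN l a : psi l (- a) = - psi l a.
Proof. by apply: (addIr (psi l a)); rewrite -psiD !addNr psi0. Qed.

Let psiB l a b : psi l (a - b) = psi l a - psi l b.
Proof. by rewrite psiD psiN. Qed.

Let phiXn i n : phi (X i ^+ n) = x i ^+ n.
Proof. by rewrite rmorphXn /= phiX. Qed.

Let psiXn l i n : psi l (X i ^+ n) = 0.
Proof.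
elim: n => [|n IHn].
  by have := psiM l 1 1; rewrite !mulr1 !rmorph1 mulr1 mul1r => /(canLR (addrK _)); rewrite subrr.
by rewrite exprS psiM IHn psiX mul0r mulr0 addr0.
Qed.

Let psiXM l i n a : psi l (X i ^+ n * a) = x i ^+ n * psi l a.
Proof. by rewrite psiM psiXn mul0r add0r phiXn. Qed.

Let psiXXM l i j n a : psi l ((X i * X j) ^+ n * a) = (x i * x j) ^+ n * psi l a.
Proof. by rewrite !exprMn -!mulrA !psiXM. Qed.

Let del_xnM i n f : del (x i ^+ n * f) = x i ^+ n * del f.
Proof.
by elim: n => [|n IHn]; [rewrite !expr0 !mul1r|rewrite exprS -!mulrA del_xM IHn].
Qed.

Let lift_phi_ge (J : finType) (i : J -> 'I_3) (f : J -> P) :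
  exists m (a : J -> R), forall j, phi (a j) = x (i j) ^+ m * f j.
Proof.
have [m mP] := choice (fun j => lift_phi (i j) (f j)).
have [a aP] := choice mP.
exists (\max_j m j), (fun j => X (i j) ^+ (\max_j m j - m j) * a j) => j.
by rewrite rmorphM phiXn aP mulrA -exprD subnK // leq_bigmax.
Qed.

Let kill (J : finType) (i : J -> 'I_3) (a : J -> R) :
    (forall j, phi (a j) = 0) -> (forall j l, psi l (a j) = 0) ->
  exists m, forall j, X (i j) ^+ m * a j = 0.
Proof.
move=> phia psia; have [m mP] := choice (fun j => ker_phi_psi (i j) (phia j) (psia j)).
exists (\max_j m j) => j; rewrite -(subnK (leq_bigmax j)) exprD -mulrA mP mulr0 //.
Qed.

Local Notation cocycle := (koszul_cocycle (X 0) (X 1) (X 2%:R)).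
Local Notation trivial := (cech_trivial (X 0) (X 1) (X 2%:R)).

Let proportional n (b : 'I_3 -> P) :
    (forall i, x i ^+ n * b 0 = x 0 ^+ n * b i) ->
  exists h, forall i, b i = x i ^+ n * h.
Proof.
move=> bE; have [h [b0 b1]] := xpow_proportional DxM DxM_neq (isT : 0 != 1 :> 'I_3) (bE 1).
exists h => i; apply: (xpow_inj DxM (i := 0) (n := n)).
by rewrite -bE b0 mulrCA.
Qed.

Let ord3_ind (K : 'I_3 -> Prop) : K 0 -> K 1 -> K 2%:R -> forall i, K i.
Proof.
move=> K0 K1 K2 [[|[|[|//]]] lt_i].
- by rewrite (_ : Ordinal _ = 0) //; apply: val_inj.
- by rewrite (_ : Ordinal _ = 1) //; apply: val_inj.
- by rewrite (_ : Ordinal _ = 2%:R) //; apply: val_inj.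
Qed.

Definition pair3 (V : Type) (a b c : V) : 'I_3 -> V := fun i => nth a [:: a; b; c] i.

(** The last hypothesis puts each [v _ i] in the conormal sheaf, so up to a power of [X i] it is the
    normal part of a combination [T i] of minors. Subtracting the coboundary of [T] leaves elements
    killed by [phi] and every [psi l], hence torsion. *)
Let trivial_conormal n a b c (v : 'I_3 -> 'I_3 -> P) :
    phi a = 0 -> phi b = 0 -> phi c = 0 ->
    (forall l, [/\ psi l a = x 1 ^+ n * v l 0 - x 0 ^+ n * v l 1,
       psi l b = x 2%:R ^+ n * v l 0 - x 0 ^+ n * v l 2%:R
     & psi l c = x 2%:R ^+ n * v l 1 - x 1 ^+ n * v l 2%:R]) ->
    (forall i, \sum_l x l * v l i = 0) -> trivial n a b c.
Proof.
move=> a0 b0 c0 psiE div0.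
have [m [B BE]] := lift_phi_ge (fun li : 'I_3 * 'I_3 => li.2) (fun li => v li.1 li.2).
pose T i := \sum_l B (l, i) * (U l * X i - X l * U i).
have phiT i : phi (T i) = 0.
  rewrite rmorph_sum big1 // => l _; rewrite rmorphM rmorphB !rmorphM /= !phiX !phiU.
  ring.
have psi_sum k (F : 'I_3 -> R) : psi k (\sum_l F l) = \sum_l psi k (F l).
  by apply: (big_morph (psi k)); [exact: psiD|exact: psi0].
have psiT k i : psi k (T i) = x i ^+ m.+1 * v k i.
  rewrite psi_sum.
  transitivity (\sum_l x i ^+ m * v l i * ((k == l)%:R * x i - x l * (k == i)%:R)).
    apply: eq_bigr => l _; rewrite psiM BE rmorphB psiB !rmorphM !psiM /= !psiX !psiU !phiX !phiU /=.
    ring.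
  transitivity (x i ^+ m.+1 * (\sum_l (k == l)%:R * v l i) - x i ^+ m * (k == i)%:R * \sum_l x l * v l i).
    by rewrite !mulr_sumr -sumrB; apply: eq_bigr => l _; rewrite exprS; ring.
  rewrite div0 mulr0 subr0 (bigD1 k) //= eqxx mul1r big1 ?addr0 // => l /negbTE kl.
  by rewrite eq_sym kl mul0r.
have phi0 i j r : phi r = 0 ->
    phi ((X i * X j) ^+ m.+1 * r - (X j ^+ (n + m.+1) * T i - X i ^+ (n + m.+1) * T j)) = 0.
  by move=> r0; rewrite !rmorphB !rmorphM /= r0 !phiT !mulr0 !subr0.
have psi0' l i j r : psi l r = x j ^+ n * v l i - x i ^+ n * v l j ->
    psi l ((X i * X j) ^+ m.+1 * r - (X j ^+ (n + m.+1) * T i - X i ^+ (n + m.+1) * T j)) = 0.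
  by move=> rE; rewrite !psiB psiXXM !psiXM rE !psiT !exprD !exprMn; ring.
apply: (@cech_trivial_shift _ _ _ _ n m.+1 a b c (T 0) (T 1) (T 2%:R)).
set a' := _ - _; set b' := (X 0 * _) ^+ _ * b - _; set c' := (X 1 * _) ^+ _ * c - _.
have [||e eP] := kill (pair3 0 0 1) (a := pair3 a' b' c').
- by apply: ord3_ind; apply: phi0.
- by apply: ord3_ind => l; have [? ? ?] := psiE l; apply: psi0'.
by apply: (@cech_trivial_torsion _ _ _ _ _ e); [exact: eP 0|exact: eP 1|exact: eP 2%:R].
Qed.


Let sumx (v : 'I_3 -> P) := \sum_l x l * v l.

Let sumxZ f v : sumx (fun l => f * v l) = f * sumx v.
Proof. by rewrite /sumx mulr_sumr; apply: eq_bigr => l _; rewrite mulrCA. Qed.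

Let sumxB u v : sumx (fun l => u l - v l) = sumx u - sumx v.
Proof. by rewrite /sumx -sumrB; apply: eq_bigr => l _; rewrite mulrBr. Qed.

Let eps_sumx v : eps (sumx v) = 0.
Proof. by rewrite rmorph_sum big1 // => l _; rewrite rmorphM eps_x mul0r. Qed.

(* With symbol 0 the cocycle lives in the conormal module; [beta] is its image
   under the connecting map to [P / (x_0, x_1, x_2)]. *)
Let conormal_criterion n a b c : phi a = 0 -> phi b = 0 -> phi c = 0 ->
    cocycle n a b c -> exists beta, forall g f,
  eps (phi g) * beta = f^`() -> trivial n (g * a) (g * b) (g * c).
Proof.
move=> a0 b0 c0 rel.
have ex_v l : exists v : 'I_3 -> P, [/\ psi l a = x 1 ^+ n * v 0 - x 0 ^+ n * v 1,
    psi l b = x 2%:R ^+ n * v 0 - x 0 ^+ n * v 2%:R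
  & psi l c = x 2%:R ^+ n * v 1 - x 1 ^+ n * v 2%:R].
  have /(congr1 (psi l)) := rel; rewrite psi0 psiD psiB !psiXM.
  move/(xpow_cocycle (i := 0) (j := 1) (l := 2%:R) DB DxM DxM_neq isT isT isT).
  by move=> [s0 [s1 [s2 [aE bE cE]]]]; exists (pair3 s0 s1 s2).
have [v vE] := choice ex_v.
have divE i j r : phi r = 0 -> (forall l, psi l r = x j ^+ n * v l i - x i ^+ n * v l j) ->
    x j ^+ n * sumx (v^~ i) = x i ^+ n * sumx (v^~ j).
  move=> r0 rE; apply/eqP; rewrite -subr_eq0 -!sumxZ -sumxB; apply/eqP.
  transitivity (del (phi r)).
    by rewrite del_phi; apply: eq_bigr => l _; rewrite rE.
  rewrite r0; have := del_phi 0; rewrite rmorph0 => ->.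
  by rewrite big1 // => l _; rewrite psi0 mulr0.
(* By [divE] the sums agree up to the powers of the [x i], so they glue to one function on the
   chart. *)
have [beta betaE] : exists beta, forall i, sumx (v^~ i) = x i ^+ n * beta.
  apply: proportional; apply: ord3_ind => //.
    by apply: (divE _ _ _ a0) => l; have [] := vE l.
  by apply: (divE _ _ _ b0) => l; have [] := vE l.
exists (eps beta) => g f gf.
have [h hE] : exists h, phi g * beta - del (eta f) = sumx h.
  by apply: eps_ker; rewrite rmorphB rmorphM /= eps_del eps_eta gf subrr.
have [m [s sE]] := lift_phi_ge (fun i : 'I_3 => i) (fun=> eta f).
have {s sE}[S phiS] : exists S, forall i, phi (S i) = x i ^+ (n + m) * eta f.
  by exists (fun i => X i ^+ n * s i) => i; rewrite rmorphM phiXn sE mulrA -exprD.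
(* The sum over [l] of [x l * w l i] is [x i ^+ (n + m) * (phi g * beta - del (eta f) - sumx h)],
   which vanishes by the choice of [h]; the term in [h] cancels in the coboundary. *)
pose w l i := x i ^+ m * phi g * v l i - psi l (S i) - x i ^+ (n + m) * h l.
apply: (@cech_trivial_shift _ _ _ _ n m _ _ _ (S 0) (S 1) (S 2%:R)).
have phi0 i j r : phi r = 0 ->
    phi ((X i * X j) ^+ m * (g * r) - (X j ^+ (n + m) * S i - X i ^+ (n + m) * S j)) = 0.
  by move=> r0; rewrite !rmorphB !rmorphM /= r0 !phiS !phiXn; ring.
have psiE l i j r : phi r = 0 -> psi l r = x j ^+ n * v l i - x i ^+ n * v l j ->
    psi l ((X i * X j) ^+ m * (g * r) - (X j ^+ (n + m) * S i - X i ^+ (n + m) * S j)) =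
    x j ^+ (n + m) * w l i - x i ^+ (n + m) * w l j.
  move=> r0 rE; rewrite !psiB psiXXM !psiXM psiM r0 rE /w !exprD !exprMn; ring.
apply: (@trivial_conormal (n + m) _ _ _ w); [exact: phi0|exact: phi0|exact: phi0| |].
  by move=> l; have [? ? ?] := vE l; split; apply: psiE.
move=> i; rewrite -/(sumx (w^~ i)) /w !sumxB !sumxZ betaE -hE.
have -> : sumx (psi^~ (S i)) = del (phi (S i)) by rewrite del_phi.
by rewrite phiS del_xnM exprD; ring.
Qed.

(** Koszul exactness over [P] makes the image under [phi] a coboundary; subtracting a lift of it
    reduces to a cocycle killed by [phi]. *)
Lemma koszul_criterion n a b c : cocycle n a b c -> exists beta, forall g f,
  eps (phi g) * beta = f^`() -> trivial n (g * a) (g * b) (g * c).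
Proof.
move=> rel; have /(congr1 phi) := rel; rewrite rmorph0 rmorphD rmorphB !rmorphM /= !phiXn.
move/(xpow_cocycle (i := 0) (j := 1) (l := 2%:R) DB DxM DxM_neq isT isT isT).
move=> [s0 [s1 [s2 [aE bE cE]]]].
have [m [S SE]] := lift_phi_ge (fun i : 'I_3 => i) (pair3 s0 s1 s2).
have := koszul_cocycle_shift m (S 0) (S 1) (S 2%:R) rel.
have phi0 i j r : phi r = x j ^+ n * pair3 s0 s1 s2 i - x i ^+ n * pair3 s0 s1 s2 j ->
    phi ((X i * X j) ^+ m * r - (X j ^+ (n + m) * S i - X i ^+ (n + m) * S j)) = 0.
  by move=> rE; rewrite !rmorphB !rmorphM /= rmorphXn rmorphM /= !phiX !phiXn rE !SE !exprD !exprMn; ring.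
move/conormal_criterion => [||| beta betaP]; [exact: phi0|exact: phi0|exact: phi0|].
exists beta => g f /betaP.
rewrite ![g * (_ - _)]mulrBr ![g * (_ ^+ m * _)]mulrCA ![g * (_ ^+ (n + m) * _)]mulrCA.
exact: cech_trivial_shift.
Qed.

Hypothesis minor_mul0 : forall i j k l,
  (U i * X j - U j * X i) * (U k * X l - U l * X k) = 0.

(** Over [(X i * X j) ^+ n.+1] this is [t^n (u_i/x_i - u_j/x_j)] with [t = u_i/x_i], the
    representative of [t^n]. *)
Definition power_cocycle n i j : R :=
  U i ^+ n * X j ^+ n * (U i * X j - U j * X i).

Lemma power_cocycleP n :
  cocycle n.+1 (power_cocycle n 0 1) (power_cocycle n 0 2%:R) (power_cocycle n 1 2%:R).
Proof.
(* Products of two minors vanish, so [U i * X j] and [U j * X i] act alike on a minor. *)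
have exch i j k l : (U i * X j) ^+ n * (U k * X l - U l * X k) =
    (U j * X i) ^+ n * (U k * X l - U l * X k).
  elim: n => [|m IHm]; first by rewrite !expr0.
  apply/eqP; rewrite -subr_eq0; apply/eqP.
  rewrite !exprS -!mulrA IHm.
  transitivity ((U j * X i) ^+ m * ((U i * X j - U j * X i) * (U k * X l - U l * X k))).
    by ring.
  by rewrite minor_mul0 mulr0.
have /(congr1 (fun r => X 0 * X 2%:R ^+ n * r)) := exch 1 0 1 2%:R.
rewrite !exprMn /koszul_cocycle /power_cocycle !exprS => e12.
transitivity (X 1 ^+ n * X 2%:R ^+ n * U 0 ^+ n * (X 2%:R * (U 0 * X 1 - U 1 * X 0)
    - X 1 * (U 0 * X 2%:R - U 2%:R * X 0)) +
  X 0 * X 2%:R ^+ n * (U 1 ^+ n * X 0 ^+ n * (U 1 * X 2%:R - U 2%:R * X 1))); first by ring.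
by rewrite e12; ring.
Qed.

(** The values [phi (s i)] glue to a function [F], and the normal derivatives of the [s i],
    corrected by those of the cocycle, glue to [H]. The chain rule gives
    [sumx H = del F - phi g * t ^+ n], and [eps] kills the left side. *)
Lemma power_cocycle_trivial n g :
  trivial n.+1 (g * power_cocycle n 0 1) (g * power_cocycle n 0 2%:R) (g * power_cocycle n 1 2%:R) ->
  exists f, eps (phi g) * 'X^n = f^`().
Proof.
move=> [m [s0 [s1 [s2 []]]]]; set N := (n.+1 + m)%N; pose s := pair3 s0 s1 s2.
rewrite -[s0]/(s 0) -[s1]/(s 1) -[s2]/(s 2%:R) => aE bE _.
have phiE i j : (X i * X j) ^+ m * (g * power_cocycle n i j) = X j ^+ N * s i - X i ^+ N * s j ->
    x j ^+ N * phi (s i) = x i ^+ N * phi (s j).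
  move=> /(congr1 phi); rewrite rmorphB !rmorphM /= rmorphXn rmorphB !rmorphM /= !phiU !phiXn !phiX => pE.
  apply/eqP; rewrite -subr_eq0 -pE; apply/eqP; ring.
have [F FE] : exists F, forall i, phi (s i) = x i ^+ N * F.
  by apply: proportional; apply: ord3_ind => //; [exact: phiE aE|exact: phiE bE].
pose h l i := psi l (s i) - (l == i)%:R * phi g * t ^+ n * x i ^+ (n + m).
have hE l i j : (X i * X j) ^+ m * (g * power_cocycle n i j) = X j ^+ N * s i - X i ^+ N * s j ->
    x j ^+ N * h l i = x i ^+ N * h l j.
  move=> /(congr1 (psi l)); rewrite psiXXM psiM psiB !psiXM.
  have -> : phi (power_cocycle n i j) = 0.
    by rewrite /power_cocycle rmorphM rmorphB !rmorphM /= !phiU !phiX; ring.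
  have -> : psi l (power_cocycle n i j) = (x i * t) ^+ n * x j ^+ n *
      ((l == i)%:R * x j - (l == j)%:R * x i).
    rewrite /power_cocycle psiM psiB !psiM rmorphB !rmorphM !rmorphXn /= !phiU !phiX !psiX !psiU; ring.
  rewrite mulr0 add0r => pE; apply/eqP; rewrite -subr_eq0; apply/eqP.
  transitivity (x j ^+ N * psi l (s i) - x i ^+ N * psi l (s j) -
    phi g * t ^+ n * ((l == i)%:R * x j ^+ N * x i ^+ (n + m) - (l == j)%:R * x i ^+ N * x j ^+ (n + m))).
    by rewrite /h; ring.
  by rewrite -pE /N !exprD !exprS !exprMn; ring.
have ex_H l : exists H, forall i, h l i = x i ^+ N * H.
  by apply: proportional; apply: ord3_ind => //; [exact: hE aE|exact: hE bE].
have [H HE] := choice ex_H; exists (eps F).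
have : sumx H = del F - phi g * t ^+ n.
  apply: (xpow_inj DxM (i := 0) (n := N)); rewrite -sumxZ mulrBr -del_xnM -FE del_phi -/(sumx (psi^~ _)).
  transitivity (sumx (h^~ 0)); first by apply: eq_bigr => l _; rewrite HE.
  rewrite sumxB; congr (_ - _).
  rewrite /sumx (bigD1 0) //= big1 ?addr0 => [|l /negbTE ->]; last by rewrite !mul0r mulr0.
  by rewrite /N addSn exprS; ring.
move/(congr1 eps); rewrite eps_sumx rmorphB rmorphM /= rmorphXn eps_t eps_del => /eqP.
by rewrite eq_sym subr_eq0 => /eqP ->.
Qed.

End FirstOrderThickening.

(** * Coordinates on the ring R *)

Local Open Scope quotient_scope.

Lemma zmpoly_ind n (K : {mpoly int[n]} -> Prop) : K 1 ->
    (forall p q, K p -> K q -> K (p - q)) -> (forall p q, K p -> K q -> K (p * q)) ->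
    (forall i, K 'X_i) -> forall p, K p.
Proof.
move=> K1 KB KM KX.
have K0 : K 0 by rewrite -(subrr 1); apply: KB.
have KD p q : K p -> K q -> K (p + q).
  by move=> Kp Kq; rewrite -[q]opprK -[- q]sub0r; apply: (KB) => //; apply: KB.
have Kz (c : int) : K c%:~R.
  have Kn (l : nat) : K (l%:R) by elim: l => [//|l IHl]; rewrite -addn1 natrD; apply: KD.
  by case: c => l; rewrite ?NegzE ?mulrNz -?pmulrn // -sub0r; apply: KB.
have KXn p l : K p -> K (p ^+ l).
  by move=> Kp; elim: l => [|l IHl]; rewrite ?expr0 // exprS; apply: KM.
elim/mpolyind => // c m p _ _ Kp; apply: (KD) => //.
rewrite -mul_mpolyC -[c]intz rmorph_int; apply: (KM) => //.
by rewrite mpolyXE_id; apply: (big_ind K) => // i _; apply: KXn.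
Qed.

Lemma mpoly_split0 n (p : {mpoly int[n]}) :
  exists h : 'I_n -> {mpoly int[n]}, p = (p@_0%MM)%:MP + \sum_i 'X_i * h i.
Proof.
elim/zmpoly_ind: p => [|p q [h pE] [k qE]|p q [h pE] [k qE]|i].
- by exists (fun=> 0); rewrite mcoeff1 eqxx mpolyC1 big1 ?addr0 // => i _; rewrite mulr0.
- exists (fun i => h i - k i).
  rewrite (eq_bigr (fun i => 'X_i * h i - 'X_i * k i)) => [|i _]; last by rewrite mulrBr.
  by rewrite sumrB mcoeffB mpolyCB addrACA -opprD -pE -qE.
- exists (fun i => h i * q + (p@_0%MM)%:MP * k i).
  rewrite (eq_bigr (fun i => ('X_i * h i) * q + (p@_0%MM)%:MP * ('X_i * k i))) => [|i _]; last first.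
    by ring.
  rewrite big_split /= -mulr_suml -mulr_sumr rmorphM /= mpolyCM addrCA -mulrDr -qE.
  by rewrite -mulrDl addrC -pE.
- exists (fun j => (i == j)%:R); rewrite mcoeffX mnm1_eq0 mpolyC0 add0r.
  rewrite (bigD1 i) //= eqxx mulr1 big1 ?addr0 // => j /negbTE ji.
  by rewrite eq_sym ji mulr0.
Qed.

Lemma ord6P (k : 'I_6) : exists i : 'I_3, k = inord i \/ k = inord (3 + i).
Proof.
have [lt_k3|le_3k] := ltnP k 3; first by exists (Ordinal lt_k3); left; rewrite /= inord_val.
have lt_k : (k - 3 < 3)%N by have := ltn_ord k; lia.
by exists (Ordinal lt_k); right; rewrite /= subnKC // inord_val.
Qed.

Lemma ord3_lt6 (i : 'I_3) : (i < 6)%N /\ (3 + i < 6)%N.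
Proof. by have := ltn_ord i; lia. Qed.

Definition cls : zpoly6 -> ringR := \pi_{ideal_quot minors_sq_pred}.
HB.instance Definition _ := GRing.RMorphism.copy cls (\pi_{ideal_quot minors_sq_pred}).

Lemma cls_surj (r : ringR) : exists p, cls p = r.
Proof. by exists (repr (r : {ideal_quot minors_sq_pred})); exact: reprK. Qed.

Lemma cls_eq p q : cls p = cls q <-> ideal_pow minors_ideal 2 (p - q).
Proof.
have -> : ideal_pow minors_ideal 2 (p - q) <-> (p - q) \in minors_sq_pred by rewrite inE.
by rewrite Quotient.idealrBE; split=> [/eqP|/eqP].
Qed.

Lemma minors_sq_sub (K : set zpoly6) : ideal K ->
  (forall a b, minors_ideal a -> minors_ideal b -> K (a * b)) -> ideal_pow minors_ideal 2 `<=` K.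
Proof.
move=> idK Kab; apply: ideal_gen_sub => // _ [a Ia [b Ib <-]]; apply: Kab => //.
have idI : ideal minors_ideal by exact: ideal_genP.
have [_ _ IM] := idI.
by apply: (ideal_gen_sub idI) Ib => _ [c Ic [d _ <-]]; rewrite mulrC; apply: IM.
Qed.

Lemma cls_minors_mul a b : minors_ideal a -> minors_ideal b -> cls a * cls b = 0.
Proof.
move=> Ia Ib; rewrite -rmorphM -[RHS](rmorph0 cls); apply/cls_eq; rewrite subr0.
apply: sub_ideal_gen; exists a => //; exists b => //.
by apply: sub_ideal_gen; exists b => //; exists 1; rewrite ?mulr1.
Qed.

Section Descent.
Variables (S : comNzRingType) (f : {rmorphism zpoly6 -> S}).
Hypothesis f_minor : forall i j : 'I_3, f (xu_minor i j) = 0.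

Lemma ker_minors a : minors_ideal a -> f a = 0.
Proof.
apply: (@ideal_gen_sub _ _ [set a | f a = 0]) => [|_ [[->|->]|->]]; last first.
- exact: (f_minor 1 2%:R).
- exact: (f_minor 0 2%:R).
- exact: (f_minor 0 1).
split=> [|b c /= b0 c0|r b /= b0]; first exact: rmorph0.
- by rewrite rmorphD b0 c0 addr0.
- by rewrite rmorphM b0 mulr0.
Qed.

Definition descend (r : ringR) : S := f (repr (r : {ideal_quot minors_sq_pred})).

Lemma descend_cls p : descend (cls p) = f p.
Proof.
apply/eqP; rewrite -subr_eq0 -rmorphB; apply/eqP.
have : ideal_pow minors_ideal 2 (repr (cls p : {ideal_quot minors_sq_pred}) - p).
  by apply/cls_eq; exact: reprK.
apply: (@minors_sq_sub [set a | f a = 0]) => [|a b Ia _ /=]; last first.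
  by rewrite rmorphM ker_minors // mul0r.
split=> [|b c /= b0 c0|r b /= b0]; first exact: rmorph0.
- by rewrite rmorphD b0 c0 addr0.
- by rewrite rmorphM b0 mulr0.
Qed.

Lemma descend_zmod_morphism : zmod_morphism descend.
Proof.
move=> r s; have [p <-] := cls_surj r; have [q <-] := cls_surj s.
by rewrite -rmorphB !descend_cls rmorphB.
Qed.

Lemma descend_monoid_morphism : monoid_morphism descend.
Proof.
split=> [|r s]; first by rewrite -(rmorph1 cls) descend_cls rmorph1.
have [p <-] := cls_surj r; have [q <-] := cls_surj s.
by rewrite -rmorphM !descend_cls rmorphM.
Qed.

HB.instance Definition _ := GRing.isZmodMorphism.Build ringR S descend descend_zmod_morphism.
HB.instance Definition _ := GRing.isMonoidMorphism.Build ringR S descend descend_monoid_morphism.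

Definition descend_rmorphism : {rmorphism ringR -> S} := descend.

End Descent.

Local Notation W := {mpoly int[3]}.
Local Notation P := {poly W}.

Lemma xvar_mmap (S : comNzRingType) (h : 'I_6 -> S) k : (mmap intr h (xvar k) = h (inord k)).
Proof. by rewrite mmapX mmap1U. Qed.

Lemma uvar_mmap (S : comNzRingType) (h : 'I_6 -> S) k : (mmap intr h (uvar k) = h (inord (3 + k)%N)).
Proof. by rewrite mmapX mmap1U. Qed.

Lemma rmorph_minor (S : comNzRingType) (f : {rmorphism zpoly6 -> S}) i j :
  f (xu_minor i j) = f (xvar i) * f (uvar j) - f (xvar j) * f (uvar i).
Proof. by rewrite rmorphB; congr (_ - _); apply: rmorphM. Qed.

(* The coordinates [u_i = x_i t] on the locus where the minors vanish. *)
Definition chart_val (k : 'I_6) : P :=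
  if (k < 3)%N then xP int (inord k) else xP int (inord (k - 3)) * 'X.

Definition chart0 : {rmorphism zpoly6 -> P} := mmap intr chart_val.

Lemma chart0_xvar (i : 'I_3) : chart0 (xvar i) = xP int i.
Proof.
have [lt6 _] := ord3_lt6 i; transitivity (chart_val (inord i)); first exact: xvar_mmap.
by rewrite /chart_val inordK // ltn_ord inord_val.
Qed.

Lemma chart0_uvar (i : 'I_3) : chart0 (uvar i) = xP int i * 'X.
Proof.
have [_ lt6] := ord3_lt6 i; transitivity (chart_val (inord (3 + i))); first exact: uvar_mmap.
rewrite /chart_val (inordK lt6).
have -> : (3 + i < 3)%N = false by rewrite ltnNge leq_addr.
by rewrite addKn inord_val.
Qed.

Lemma mderiv_var (k l : 'I_6) : mderiv l ('X_k : zpoly6) = (l == k)%:R.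
Proof.
rewrite mderivX mnm1E eq_sym; case: eqP => [->|_]; last by rewrite scale0r.
by rewrite (_ : (U_(k) - U_(k) = 0)%MM) ?mpolyX0 ?scale1r //; apply/mnmP => i; rewrite mnmBE subnn mnm0E.
Qed.

Lemma mderiv_xvar (l i : 'I_3) : mderiv (inord (3 + l)) (xvar i) = 0.
Proof.
have [lti _] := ord3_lt6 i; have [_ ltl] := ord3_lt6 l.
by rewrite mderiv_var -val_eqE /= !inordK // gtn_eqF // (leq_trans (ltn_ord i)) // leq_addr.
Qed.

Lemma mderiv_uvar (l i : 'I_3) : mderiv (inord (3 + l)) (uvar i) = (l == i)%:R.
Proof.
have [_ lti] := ord3_lt6 i; have [_ ltl] := ord3_lt6 l.
by rewrite mderiv_var -val_eqE /= !inordK // eqn_add2l val_eqE.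
Qed.

Lemma zpoly6_ind (K : zpoly6 -> Prop) : K 1 ->
    (forall p q, K p -> K q -> K (p - q)) -> (forall p q, K p -> K q -> K (p * q)) ->
    (forall i : 'I_3, K (xvar i)) -> (forall i : 'I_3, K (uvar i)) -> forall p, K p.
Proof.
move=> K1 KB KM Kx Ku; apply: zmpoly_ind => // k.
by have [i [->|->]] := ord6P k; [exact: Kx|exact: Ku].
Qed.

Opaque chart0 xvar uvar.

Lemma chart0_minor (i j : 'I_3) : chart0 (xu_minor i j) = 0.
Proof.
rewrite rmorph_minor !chart0_xvar !chart0_uvar.
by apply/eqP; rewrite subr_eq0; apply/eqP; exact: mulrCA.
Qed.

Definition normal0 (l : 'I_3) (p : zpoly6) : P := chart0 (mderiv (inord (3 + l)%N) p).

Lemma normal0D l : {morph normal0 l : p q / p + q}.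
Proof. by move=> p q; rewrite /normal0 mderivD rmorphD. Qed.

Lemma normal0M l p q : normal0 l (p * q) = normal0 l p * chart0 q + chart0 p * normal0 l q.
Proof. by rewrite /normal0 mderivM rmorphD !rmorphM. Qed.

Lemma normal0_xvar (l i : 'I_3) : normal0 l (xvar i) = 0.
Proof. by rewrite /normal0 mderiv_xvar rmorph0. Qed.

Lemma normal0_uvar (l i : 'I_3) : normal0 l (uvar i) = (l == i)%:R.
Proof. by rewrite /normal0 mderiv_uvar rmorph_nat. Qed.

(** A derivation along [chart0] sends a product of two elements of its kernel to 0. *)
Lemma normal0_minors_sq p : ideal_pow minors_ideal 2 p -> forall l, normal0 l p = 0.
Proof.
move=> Ip; suff: chart0 p = 0 /\ forall l, normal0 l p = 0 by case.
move: p Ip; apply: (@minors_sq_sub [set p | chart0 p = 0 /\ forall l, normal0 l p = 0]) => [|a b Ia Ib /=].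
  split=> [|p q /= [p0 np] [q0 nq]|r p /= [p0 np]] /=.
  - by split=> [|l]; rewrite ?rmorph0 // /normal0 mderiv0 rmorph0.
  - by split=> [|l]; rewrite ?rmorphD ?p0 ?q0 ?addr0 // normal0D np nq addr0.
  - by split=> [|l]; rewrite ?rmorphM ?p0 ?mulr0 // normal0M p0 np !mulr0 addr0.
have a0 := ker_minors chart0_minor Ia; have b0 := ker_minors chart0_minor Ib.
by split=> [|l]; rewrite ?rmorphM ?a0 ?mul0r // normal0M a0 b0 mulr0 mul0r addr0.
Qed.

(** The chain rule for [u_l = x_l t], checked on generators; the [x_l] do not depend on [t]. *)
Lemma deriv_chart0 p : (chart0 p)^`() = \sum_(l < 3) xP int l * normal0 l p.
Proof.
elim/zpoly6_ind: p => [|p q IHp IHq|p q IHp IHq|i|i].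
- rewrite rmorph1 derivC big1 // => l _; rewrite /normal0 -mpolyC1 mderivC rmorph0; exact: mulr0.
- rewrite rmorphB derivB IHp IHq -sumrB; apply: eq_bigr => l _.
  by rewrite /normal0 mderivB rmorphB mulrBr.
- rewrite rmorphM derivM IHp IHq mulr_suml mulr_sumr -big_split; apply: eq_bigr => l _.
  by rewrite normal0M mulrDr; congr (_ + _); [exact: (esym (mulrA _ _ _))|exact: mulrCA].
- rewrite chart0_xvar derivC big1 // => l _; rewrite normal0_xvar; exact: mulr0.
rewrite chart0_uvar derivM derivX derivC mul0r add0r mulr1.
rewrite (bigD1 i) //= normal0_uvar eqxx mulr1 big1 ?addr0 // => l /negbTE li.
rewrite normal0_uvar li. exact: mulr0.
Qed.

Definition chart : {rmorphism ringR -> P} := descend_rmorphism chart0_minor.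

Lemma chart_cls p : chart (cls p) = chart0 p.
Proof. exact: (descend_cls chart0_minor). Qed.

Definition normal l (r : ringR) : P := normal0 l (repr (r : {ideal_quot minors_sq_pred})).

Lemma normal_cls l p : normal l (cls p) = normal0 l p.
Proof.
have pE : ideal_pow minors_ideal 2 (repr (cls p : {ideal_quot minors_sq_pred}) - p).
  by apply/cls_eq; exact: reprK.
have := normal0_minors_sq pE l; rewrite /normal /normal0 mderivB rmorphB => /eqP.
by rewrite subr_eq0 => /eqP.
Qed.

Lemma normalD l : {morph normal l : r s / r + s}.
Proof.
move=> r s; have [p <-] := cls_surj r; have [q <-] := cls_surj s.
by rewrite -rmorphD !normal_cls normal0D.
Qed.

Lemma normalM l r s : normal l (r * s) = normal l r * chart s + chart r * normal l s.
Proof.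
have [p <-] := cls_surj r; have [q <-] := cls_surj s.
by rewrite -rmorphM !normal_cls !chart_cls normal0M.
Qed.

Lemma deriv_chart r : (chart r)^`() = \sum_(l < 3) xP int l * normal l r.
Proof.
have [p <-] := cls_surj r; rewrite chart_cls deriv_chart0.
by apply: eq_bigr => l _; rewrite normal_cls.
Qed.

Definition xR (i : 'I_3) : ringR := cls (xvar i).
Definition uR (i : 'I_3) : ringR := cls (uvar i).

Lemma chart_xR i : chart (xR i) = xP int i.
Proof. by rewrite chart_cls chart0_xvar. Qed.

Lemma chart_uR i : chart (uR i) = xP int i * 'X.
Proof. by rewrite chart_cls chart0_uvar. Qed.

Lemma normal_xR l i : normal l (xR i) = 0.
Proof. by rewrite /xR normal_cls normal0_xvar. Qed.

Lemma normal_uR l i : normal l (uR i) = (l == i)%:R.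
Proof. by rewrite /uR normal_cls normal0_uvar. Qed.

Lemma minors_idealP (i j : 'I_3) : minors_ideal (xu_minor i j).
Proof.
have [I0 ID IM] := ideal_genP [set xu_minor 0%N 1%N; xu_minor 0%N 2%N; xu_minor 1%N 2%N].
have gen (k l : 'I_3) : (k < l)%N -> minors_ideal (xu_minor k l).
  move=> lt_kl; apply: sub_ideal_gen.
  case: k l lt_kl => [[|[|[|//]]] k] [[|[|[|//]]] l] //= _; [by left; left|by left; right|by right].
case: (ltngtP i j) => [/gen//|/gen Iji|/val_inj->].
  have -> : xu_minor i j = -1 * xu_minor j i by rewrite /xu_minor mulN1r opprB.
  exact: IM.
by rewrite /xu_minor subrr; exact: I0.
Qed.

Definition minorR (i j : 'I_3) : ringR := uR i * xR j - uR j * xR i.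

Lemma minorR_mul0 i j k l : minorR i j * minorR k l = 0.
Proof.
have minorE i' j' : minorR i' j' = cls (xu_minor j' i').
  by rewrite /minorR /xu_minor rmorphB !rmorphM mulrC [_ * xR i']mulrC.
by rewrite !minorE cls_minors_mul //; exact: minors_idealP.
Qed.

Lemma ringR_ind (K : ringR -> Prop) : K 1 -> (forall r s, K r -> K s -> K (r - s)) ->
  (forall r s, K r -> K s -> K (r * s)) -> (forall i, K (xR i)) -> (forall i, K (uR i)) ->
  forall r, K r.
Proof.
move=> K1 KB KM Kx Ku r; have [p <-] := cls_surj r.
elim/zpoly6_ind: p => [|p q Kp Kq|p q Kp Kq|i|i]; rewrite ?rmorph1 ?rmorphB ?rmorphM //.
- exact: KB.
- exact: KM.
- exact: Kx.
- exact: Ku.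
Qed.

Lemma noetherian_ringR : noetherian ringR.
Proof.
have [Q [h [noQ hP]]] := noetherian_adjoin ([seq xR i | i : 'I_3] ++ [seq uR i | i : 'I_3]).
apply: (noetherian_image (h := h)) noQ _.
elim/ringR_ind => [|r s [p <-] [q <-]|r s [p <-] [q <-]|i|i].
- by exists 1; rewrite rmorph1.
- by exists (p - q); rewrite rmorphB.
- by exists (p * q); rewrite rmorphM.
- by apply: hP; rewrite mem_cat map_f ?mem_enum.
- by apply: hP; rewrite mem_cat orbC map_f ?mem_enum.
Qed.

(* Evaluation at [x = 0]; the variable [t] stays free. *)
Definition at_origin : {rmorphism P -> {poly int}} := map_poly (mcoeff 0%MM : {rmorphism W -> int}).

Definition const_in_x (f : {poly int}) : P := map_poly (@mpolyC 3 int) f.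

Lemma at_origin_x i : at_origin (xP int i) = 0.
Proof. by rewrite /at_origin /= map_polyC /= mcoeffX mnm1_eq0 polyC0. Qed.

Lemma at_origin_t : at_origin 'X = 'X.
Proof. exact: map_polyX. Qed.

Lemma at_origin_const f : at_origin (const_in_x f) = f.
Proof. by apply/polyP => k; rewrite !coef_map /= mpolyCK. Qed.

Lemma at_origin_deriv (f : P) : at_origin (f^`()) = (at_origin f)^`().
Proof. by rewrite /at_origin /= deriv_map. Qed.

Lemma at_origin_ker f : at_origin f = 0 -> exists h, f = \sum_(l < 3) xP int l * h l.
Proof.
move=> /polyP f0; have [h hE] := choice (fun k => mpoly_split0 f`_k).
exists (fun l => \poly_(k < size f) h k l); apply/polyP => k; rewrite coef_sum.
have f0k : (f`_k)@_0 = 0 by have := f0 k; rewrite coef_map coef0.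
have [lt_k|le_k] := ltnP k (size f); last first.
  rewrite nth_default // big1 // => l _; rewrite coefCM coef_poly ltnNge le_k; exact: mulr0.
rewrite hE f0k mpolyC0 add0r; apply: eq_bigr => l _.
by rewrite coefCM coef_poly lt_k.
Qed.

Definition constR : {rmorphism W -> ringR} := mmap intr xR.

Lemma constR_X i : constR 'X_i = xR i.
Proof. by rewrite /constR /= mmapX mmap1U. Qed.

Lemma chart_constR w : chart (constR w) = w%:P.
Proof.
elim/zmpoly_ind: w => [|p q IHp IHq|p q IHp IHq|i].
- by rewrite !rmorph1.
- by rewrite !rmorphB IHp IHq.
- by rewrite !rmorphM IHp IHq.
- by rewrite constR_X chart_xR.
Qed.

Lemma chart_lift i (f : P) : exists m a, chart a = xP int i ^+ m * f.
Proof.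
elim/poly_ind: f => [|f c [m [a aE]]].
  by exists 0%N, 0; rewrite rmorph0; exact: (esym (mulr0 _)).
(* A Horner step in which [t] is lifted as [u_i / x_i], at the cost of one power of [x_i]. *)
exists m.+1, (a * uR i + xR i ^+ m.+1 * constR c).
rewrite rmorphD !rmorphM rmorphXn chart_uR chart_xR chart_constR aE.
by rewrite mulrDr; congr (_ + _); rewrite exprSr -!mulrA; congr (_ * _); rewrite mulrCA.
Qed.

Transparent chart0 xvar uvar.

(** The section [t = u_i / x_i] freed of denominators: composed with [chart] it is
    [G(x, t) |-> G(x, x_i t)], which is injective. *)
Definition sectionR (i : 'I_3) : {rmorphism P -> ringR} :=
  horner_eval (uR i) \o map_poly constR.

Lemma sectionR_X i : sectionR i 'X = uR i.
Proof. by rewrite /sectionR /= map_polyX /horner_eval hornerX. Qed.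

Lemma sectionR_C i w : sectionR i w%:P = constR w.
Proof. by rewrite /sectionR /= map_polyC /horner_eval hornerC. Qed.

Lemma sectionR_x i j : sectionR i (xP int j) = xR j.
Proof. by rewrite sectionR_C constR_X. Qed.

Opaque sectionR chart constR.

Lemma coef_chart_sectionR i G k : (chart (sectionR i G))`_k = G`_k * 'X_i ^+ k.
Proof.
elim/poly_ind: G k => [|G w IHG] k.
  by rewrite !rmorph0 !coef0; exact: (esym (mul0r _)).
rewrite !rmorphD !rmorphM sectionR_X chart_uR sectionR_C chart_constR mulrA.
rewrite !coefD !coefMX !coefC; case: k => [|k] /=; first by rewrite !add0r expr0; exact: (esym (mulr1 _)).
by rewrite !addr0 coefMC IHG exprSr; exact: (esym (mulrA _ _ _)).
Qed.

Lemma chart_sectionR_inj i G : chart (sectionR i G) = 0 -> G = 0.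
Proof.
move=> G0; apply/polyP => k; rewrite coef0.
have := coef_chart_sectionR i G k; rewrite G0 coef0 mulrC => /(congr1 (mdrop i k)).
by rewrite mdrop_XnM mdrop0.
Qed.

Lemma chart_minorR l i : chart (minorR l i) = 0.
Proof.
have swap (S : comNzRingType) (a b c : S) : a * b * c - c * b * a = 0 by ring.
by rewrite rmorphB !rmorphM !chart_uR !chart_xR; exact: swap.
Qed.

Lemma normal_minorR k l i : normal k (minorR l i) = (k == l)%:R * xP int i - (k == i)%:R * xP int l.
Proof.
have E a b : normal k (uR a * xR b) = (k == a)%:R * xP int b.
  by rewrite normalM normal_uR normal_xR chart_xR mulr0 addr0.
have normalN a b : normal k (a - b) = normal k a - normal k b.
  by have := normalD k (a - b) b; rewrite subrK => ->; rewrite addrK.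
by rewrite normalN !E.
Qed.

(* First-order Taylor expansion around the locus of rank-one matrices. *)
Lemma taylor i (r : ringR) : exists m G (Gl : 'I_3 -> P),
  xR i ^+ m * r = sectionR i G + \sum_l sectionR i (Gl l) * minorR l i.
Proof.
elim/ringR_ind: r => [|r s [m [G [Gl rE]]] [n [H [Hl sE]]]|r s [m [G [Gl rE]]] [n [H [Hl sE]]]|j|j].
- exists 0%N, 1, (fun=> 0); rewrite rmorph1 big1 ?addr0 ?mulr1 // => l _.
  by rewrite rmorph0 mul0r.
- exists (m + n)%N, (xP int i ^+ n * G - xP int i ^+ m * H).
  exists (fun l => xP int i ^+ n * Gl l - xP int i ^+ m * Hl l).
  transitivity (xR i ^+ n * (xR i ^+ m * r) - xR i ^+ m * (xR i ^+ n * s)).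
    by rewrite exprD; ring.
  rewrite rE sE rmorphB !rmorphM !rmorphXn sectionR_x !mulrDr !mulr_sumr.
  rewrite opprD addrACA -sumrB; congr (_ + _); apply: eq_bigr => l _.
  by rewrite rmorphB !rmorphM !rmorphXn sectionR_x; ring.
- exists (m + n)%N, (G * H), (fun l => G * Hl l + H * Gl l).
  transitivity ((xR i ^+ m * r) * (xR i ^+ n * s)); first by rewrite exprD; ring.
  rewrite rE sE rmorphM mulrDl !mulrDr -!addrA; congr (_ + _).
  rewrite [X in _ + (_ + X)](_ : _ = 0) ?addr0; last first.
    rewrite mulr_suml big1 // => k _; rewrite mulr_sumr big1 // => l _.
    by rewrite mulrACA minorR_mul0 mulr0.
  rewrite mulr_sumr mulr_suml -big_split; apply: eq_bigr => l _.
  by rewrite rmorphD !rmorphM /=; ring.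
- exists 0%N, (xP int j), (fun=> 0); rewrite sectionR_x big1 ?addr0 ?mul1r // => l _.
  by rewrite rmorph0 mul0r.
(* This is [x_i u_j = u_i x_j + (u_j x_i - u_i x_j)]. *)
- exists 1%N, ('X * xP int j), (fun l => (l == j)%:R); rewrite rmorphM sectionR_X sectionR_x.
  rewrite (bigD1 j) //= eqxx rmorph1 big1 => [|l /negbTE ->]; last by rewrite rmorph0 mul0r.
  by rewrite /minorR; ring.
Qed.

(** In the Taylor expansion of [r], [chart] detects [G], and [normal k] then detects [Gl k] for
    [k != i]; the minor with [k = i] is 0. *)
Lemma chart_normal_ker i r : chart r = 0 -> (forall l, normal l r = 0) ->
  exists m, xR i ^+ m * r = 0.
Proof.
move=> r0 nr0; have [m [G [Gl rE]]] := taylor i r; exists m.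
have minor_ii : minorR i i = 0 by rewrite /minorR subrr.
have G0 : G = 0.
  apply: (@chart_sectionR_inj i); have /(congr1 chart) := rE.
  rewrite rmorphM r0 mulr0 rmorphD rmorph_sum big1 ?addr0 // => l _.
  by rewrite rmorphM chart_minorR mulr0.
rewrite G0 rmorph0 add0r in rE; rewrite rE big1 // => k _.
have [->|ki] := eqVneq k i; first by rewrite minor_ii mulr0.
suff -> : Gl k = 0 by rewrite rmorph0 mul0r.
apply: (@chart_sectionR_inj i); apply: (@xpow_inj _ _ (xP int) _ (@pdrop_XnM _ _) i 1).
rewrite mulr0 expr1.
have unit_comb (S : comNzRingType) (a b c : S) : a * (true%:R * b - false%:R * c) = b * a.
  by rewrite mul0r subr0 mul1r mulrC.
have nD (s u : ringR) : normal k (s + u) = normal k s + normal k u by apply: normalD.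
have n0 : normal k 0 = 0 by apply: (addIr (normal k 0)); rewrite -nD !add0r.
transitivity (normal k (xR i ^+ m * r)); last first.
  by rewrite normalM r0 nr0 !mulr0 addr0.
rewrite rE (big_morph (normal k) nD n0) (bigD1 k) //= big1 => [|l lk].
  rewrite normalM chart_minorR mulr0 add0r normal_minorR eqxx (negbTE ki).
  by rewrite addr0; exact: (esym (unit_comb _ _ _ _)).
rewrite normalM chart_minorR normal_minorR eq_sym (negbTE lk) (negbTE ki).
by rewrite !mul0r subr0 !mulr0 addr0.
Qed.

Lemma mcoeff0_minor (i j : 'I_3) : (xu_minor i j)@_0%MM = 0.
Proof. by rewrite /xu_minor rmorphB !rmorphM /= !mcoeffX !mnm1_eq0 !mul0r subr0. Qed.

Definition constant : {rmorphism ringR -> int} :=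
  descend_rmorphism (f := mcoeff 0%MM : {rmorphism zpoly6 -> int}) mcoeff0_minor.

Lemma constant_cls p : constant (cls p) = p@_0%MM.
Proof. exact: (descend_cls mcoeff0_minor). Qed.

Lemma constant_xR i : constant (xR i) = 0.
Proof. by rewrite constant_cls mcoeffX mnm1_eq0. Qed.

Lemma constant_uR i : constant (uR i) = 0.
Proof. by rewrite constant_cls mcoeffX mnm1_eq0. Qed.

(** Since [u_i] goes to [x_i t], setting [x = 0] kills the [u_i] as well; this is why elements of
    [R] act on [Z[t]] through their constant terms. *)
Lemma at_origin_chart r : at_origin (chart r) = (constant r)%:P.
Proof.
elim/ringR_ind: r => [|r s IHr IHs|r s IHr IHs|i|i].
- by rewrite !rmorph1.
- by rewrite !rmorphB IHr IHs.
- by rewrite !rmorphM IHr IHs.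
- by rewrite chart_xR at_origin_x constant_xR polyC0.
- by rewrite chart_uR rmorphM at_origin_x constant_uR mul0r polyC0.
Qed.

Local Notation cocycleR := (koszul_cocycle (xR 0) (xR 1) (xR 2%:R)).
Local Notation trivialR := (cech_trivial (xR 0) (xR 1) (xR 2%:R)).

Lemma xP_deriv i (f : P) : (xP int i * f)^`() = xP int i * f^`().
Proof. by rewrite derivM derivC mul0r add0r. Qed.

Lemma cocycleR_criterion n a b c : cocycleR n a b c -> exists beta, forall g f,
  (constant g)%:P * beta = f^`() -> trivialR n (g * a) (g * b) (g * c).
Proof.
move=> /(koszul_criterion chart_xR chart_uR normal_xR normal_uR normalD normalM
  (@pdropB _ _) (@pdrop_XnM _ _) (@pdrop_XnM_neq _ _) xP_deriv deriv_chart
  at_origin_const at_origin_deriv at_origin_ker chart_lift chart_normal_ker)[beta betaP].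
by exists beta => g f; rewrite -at_origin_chart; exact: betaP.
Qed.

Lemma power_cocycleR n : exists a b c, cocycleR n.+1 a b c /\
  forall g, trivialR n.+1 (g * a) (g * b) (g * c) -> (n.+1%:Z %| constant g)%Z.
Proof.
exists (power_cocycle xR uR n 0 1), (power_cocycle xR uR n 0 2%:R), (power_cocycle xR uR n 1 2%:R).
split=> [|g]; first exact: power_cocycleP minorR_mul0 n.
move/(power_cocycle_trivial chart_xR chart_uR normal_xR normal_uR normalD normalM
  (@pdrop_XnM _ _) (@pdrop_XnM_neq _ _) xP_deriv deriv_chart at_origin_x at_origin_t
   at_origin_deriv) => [f].
rewrite at_origin_chart => /(congr1 (fun q : {poly int} => q`_n)).
rewrite coefCM coefXn eqxx mulr1 coef_deriv -mulr_natr => ->.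
by apply: dvdz_mull; rewrite natz.
Qed.

Section LocalCohomology.
Variable I : injective_resolution (ringR^o)%R.
Let J : set ringR := ideal_gen [set xR 0; xR 1; xR 2%:R].
Local Notation H2 := (local_cohomology J I 2).

Lemma H2_annihilators (zeta : H2) : (forall g, constant g = 0 -> g *: zeta = 0) /\
  exists2 c : nat, (0 < c)%N & (c%:R : ringR) *: zeta = 0.
Proof.
have [n [a [b [c [rel kill]]]]] := class_koszul zeta noetherian_ringR.
have [beta betaP] := cocycleR_criterion rel; split=> [g g0|].
  by apply/kill/(betaP _ 0); rewrite g0 mul0r deriv0.
(* The factorial clears the denominators of the formal antiderivative of [beta]. *)
exists (size beta)`!; first exact: fact_gt0.
(* An antiderivative of the factorial times [beta]; its coefficient at 0 is 0, division by 0 being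
   0. *)
pose f := \poly_(k < (size beta).+1) (((size beta)`! %/ k)%N%:R * beta`_k.-1).
apply/kill/(betaP _ f); apply/polyP => k.
rewrite rmorph_nat coefCM coef_deriv coef_poly ltnS.
have [lt_k|le_k] := ltnP k (size beta); last by rewrite nth_default // mul0rn mulr0.
rewrite -mulrnAl -mulrnA divnK //; apply: dvdn_fact.
by rewrite lt_k.
Qed.

Lemma H2_class n : exists zeta : H2, forall g, g *: zeta = 0 -> (n.+1%:Z %| constant g)%Z.
Proof.
have [a [b [c [rel divP]]]] := power_cocycleR n.
have [zeta zetaP] := koszul_class I noetherian_ringR rel.
by exists zeta => g /zetaP/divP.
Qed.

End LocalCohomology.

Transparent sectionR chart constR.

(** * Algebraic independence along chains of primes *)

(** A rational kernel vector exists by rank; the product of its denominators makes it integral. *)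
Lemma int_kernel (I J : finType) (M : I -> J -> int) : (#|J| < #|I|)%N ->
  exists c : I -> int, (exists i, c i != 0) /\ forall j, \sum_i c i * M i j = 0.
Proof.
move=> ltJI; pose A : 'M[rat]_(#|I|, #|J|) := \matrix_(i, j) (M (enum_val i) (enum_val j))%:~R.
have /rowV0Pn[v /sub_kermxP vA vN0] : kermx A != 0.
  rewrite kermx_eq0 /row_free neq_ltn (leq_ltn_trans (rank_leq_col A)) //.
have [i0 vi0] : exists i, v 0 i != 0.
  apply: contrapT => N; case/eqP: vN0; apply/rowP => i; rewrite mxE.
  by apply: contrapT => vi; apply: N; exists i; apply/eqP.
pose d := \prod_k denq (v 0 k).
have cP i : exists c : int, c%:~R = d%:~R * v 0 i.
  exists (numq (v 0 i) * \prod_(k | k != i) denq (v 0 k)).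
  by rewrite /d (bigD1 i isT) !intrM numqE; ring.
have [c cE] := choice cP; exists (fun i => c (enum_rank i)); split.
  exists (enum_val i0); rewrite enum_valK -(intr_eq0 rat) cE mulf_neq0 // intr_eq0.
  by apply/prodf_neq0 => k _; exact: denq_neq0.
move=> j; apply/eqP; rewrite -(intr_eq0 rat) rmorph_sum /=; apply/eqP.
transitivity (d%:~R * (v *m A) 0 (enum_rank j)); last by rewrite vA mxE mulr0.
rewrite mxE mulr_sumr (reindex enum_rank) /=; last first.
  by exists enum_val => i _; rewrite ?enum_rankK ?enum_valK.
by apply: eq_bigr => i _; rewrite mxE !enum_rankK rmorphM /= cE mulrA.
Qed.

Section IntegersInIdeals.
Variable R : comNzRingType.
Implicit Types P Q : set R.

Lemma idealB P a b : ideal P -> P a -> P b -> P (a - b).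
Proof. by move=> [_ PD PM] Pa Pb; apply: PD => //; rewrite -mulN1r; apply: PM. Qed.

Lemma ideal_addr P a b : ideal P -> P b -> P (a + b) -> P a.
Proof. by move=> idP Pb Pab; rewrite -(addrK b a); apply: idealB. Qed.

Lemma ideal_sum P (I : finType) (F : I -> R) : ideal P -> (forall i, P (F i)) -> P (\sum_i F i).
Proof. by move=> [P0 PD _] PF; apply: (big_ind P). Qed.

Lemma ideal_int P : ideal P -> exists p : nat, forall c : int, P c%:~R <-> (p%:Z %| c)%Z.
Proof.
move=> idP; have [P0 PD PM] := idP.
have [[c0 [Pc0 c0N]]|N] := EM (exists c : int, P c%:~R /\ c != 0); last first.
  exists 0%N => c; rewrite dvd0z; split=> [Pc|/eqP->//].
  by apply: contrapT => cN; apply: N; exists c; split=> //; apply/negP.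
pose V (k : nat) := `[< exists c : int, [/\ P c%:~R, c != 0 & absz c = k] >].
have exV : exists k, V k by exists `|c0|%N; apply/asboolP; exists c0.
case: (ex_minnP exV) => p /asboolP[a [Pa aN ap]] pmin; exists p => c.
have Pz (b d : int) : P b%:~R -> P (d * b)%:~R by move=> Pb; rewrite intrM; apply: PM.
have -> : (p%:Z %| c)%Z = (a %| c)%Z by rewrite -ap !dvdzE.
split=> [Pc|/dvdzP[q ->]]; last exact: Pz.
have Pr : P (c %% a)%Z%:~R.
  rewrite /modz rmorphB /=; apply: idealB => //; exact: Pz.
apply/dvdz_mod0P; apply: contrapT => /eqP rN.
have /pmin : V `|(c %% a)%Z|%N by apply/asboolP; exists (c %% a)%Z.
by have := ltz_mod c aN; have := modz_ge0 c aN; lia.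
Qed.

Lemma prime_ideal_nat P n : prime_ideal P -> (0 < n)%N -> P n%:R ->
  exists2 q, prime q & P q%:R.
Proof.
move=> [idP P1 Pm]; elim/ltn_ind: n => n IHn n_gt0 Pn.
have n1 : (1 < n)%N by case: n {IHn} n_gt0 Pn => [|[|n]].
have [pr dv] := (pdiv_prime n1, pdiv_dvd n).
have nE : n = (n %/ pdiv n * pdiv n)%N by rewrite divnK.
move: Pn; rewrite {1}nE natrM => /Pm[Pd|Pp]; last by exists (pdiv n).
apply: (IHn (n %/ pdiv n)%N) => //; first by rewrite ltn_Pdiv ?prime_gt1.
by rewrite divn_gt0 ?pdiv_gt0 // dvdn_leq.
Qed.

(** A nonzero prime of the integers is maximal, so a nonzero contraction of [Q0] equals that of
    [Q1]. *)
Lemma prime_ideal_int_dichotomy Q0 Q1 : prime_ideal Q0 -> prime_ideal Q1 -> Q0 `<=` Q1 ->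
  (forall c : int, Q1 c%:~R -> Q0 c%:~R) \/ (forall c : int, Q0 c%:~R -> c = 0).
Proof.
move=> [id0 Q01 Q0m] [id1 Q11 Q1m] sub.
have [p0 p0P] := ideal_int id0; have [p1 p1P] := ideal_int id1.
case: p0 p0P => [|p0] p0P; [right=> c|left=> c].
  by move/p0P; rewrite dvd0z => /eqP.
have [q prq Q0q] : exists2 q, prime q & Q0 q%:R.
  by apply: (@prime_ideal_nat _ p0.+1) => //; exact: ((p0P p0.+1%:Z).2 (dvdzz _)).
have q0 : (p0.+1 %| q)%N by exact: ((p0P q%:Z).1 Q0q).
have q1 : (p1 %| q)%N by exact: ((p1P q%:Z).1 (sub _ Q0q)).
have p1N : p1 != 1%N by apply: contra_notN Q11 => /eqP p11; apply/(p1P 1); rewrite p11.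
have p0N : p0.+1 != 1%N by apply: contra_notN Q01 => /eqP p11; apply/(p0P 1); rewrite p11.
have /primeP[_ qd] := prq.
move: (qd _ q0) (qd _ q1); rewrite (negbTE p1N) (negbTE p0N) /= => /eqP e0 /eqP e1.
by rewrite p0P p1P e0 e1.
Qed.

End IntegersInIdeals.

Section LinearIndependence.
Variable R : comNzRingType.
Implicit Types P Q : set R.

(* Independence in [R/P] over the image of [Z], so coefficients vanish only modulo [P]. *)
Definition lin_indep P (I : finType) (b : I -> R) : Prop :=
  forall c : I -> int, P (\sum_i (c i)%:~R * b i) -> forall i, P (c i)%:~R.

(** If [P] meets the integers in 0 and [Q] in [(q)], a relation modulo [P] has all coefficients
    divisible by [q]. For nonzero [q], which lies outside the prime [P], it can be divided by [q],
    and infinite descent applies. *)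
Lemma lin_indep_sub P Q (I : finType) (b : I -> R) : prime_ideal P -> prime_ideal Q ->
  P `<=` Q -> lin_indep Q b -> lin_indep P b.
Proof.
move=> prP prQ sub bQ; have [QP|P0] := prime_ideal_int_dichotomy prP prQ sub.
  by move=> c /sub/bQ Qc i; apply: QP.
have [[PI0 PD PM] P1 Pm] := prP; have [idQ Q1 _] := prQ; have [q qP] := ideal_int idQ.
have q1 : q != 1%N by apply: contra_notN Q1 => /eqP q1; apply/(qP 1); rewrite q1.
suff vanish e (c : I -> int) i : P (\sum_i (c i)%:~R * b i) -> (absz (c i) < e)%N -> c i = 0.
  by move=> c Pc i; rewrite (vanish (absz (c i)).+1 c i).
elim: e c => // e IHe c Pc lt_ci.
have qc j : (q%:Z %| c j)%Z by apply/qP; apply: bQ; apply: sub.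
have [q0|qN0] := eqVneq q 0%N; first by have := qc i; rewrite q0 dvd0z => /eqP.
have qE j : c j = (c j %/ q)%Z * q by rewrite divzK.
have [ci0|ciN] := eqVneq (c i) 0; first by [].
rewrite qE (IHe (fun j => c j %/ q)%Z) ?mul0r //; last first.
  have : (absz (c i %/ q)%Z * q = absz (c i))%N by rewrite {2}qE abszM.
  have : (0 < absz (c i))%N by rewrite absz_gt0.
  by nia.
have : P (q%:R * \sum_j (c j %/ q)%Z%:~R * b j).
  rewrite mulr_sumr (eq_bigr (fun j => (c j)%:~R * b j)) // => j _.
  by rewrite {2}qE intrM mulrA [q%:R * _]mulrC.
case/Pm => // Pq; have := P0 q%:Z Pq; move/eqP; rewrite -[_ == _]/(q == 0%N).
by rewrite (negbTE qN0).
Qed.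

(** Exponent vectors with entries below [D], nested as pairs so that a new element of the list peels
    off one exponent. *)
Fixpoint box (D m : nat) : finType := if m is m'.+1 then ('I_D * box D m')%type else unit.

Fixpoint monomials D (ts : seq R) : box D (size ts) -> R :=
  if ts is t :: ts' then fun e => t ^+ e.1 * monomials e.2 else fun _ => 1.

Lemma card_box D m : #|box D m| = (D ^ m)%N.
Proof. by elim: m => [|m IHm]; rewrite ?card_unit // card_prod IHm card_ord expnS. Qed.

Definition alg_indep P (ts : seq R) : Prop := forall D, lin_indep P (@monomials D ts).

Lemma alg_indep_nil P : alg_indep P [::].
Proof.
move=> D c Pc i; rewrite (_ : _%:~R = \sum_i (c i)%:~R * @monomials D [::] i) //.
by rewrite (bigD1 i) //= mulr1 big1 ?addr0 // => j; case: i j => -[].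
Qed.

(** Read a relation as a polynomial in [f]. Modulo [Q] only its constant term [B 0] survives;
    independence of [ts] puts the coefficients of [B 0] in [Q], hence in [P]. As [f] is outside [P],
    a factor [f] cancels from the rest and the argument repeats. *)
Lemma alg_indep_cons P Q f ts : prime_ideal P -> prime_ideal Q -> P `<=` Q ->
    (forall c : int, Q c%:~R -> P c%:~R) -> Q f -> ~ P f -> alg_indep Q ts ->
  alg_indep P (f :: ts).
Proof.
move=> [idP P1 Pm] [idQ _ _] sub QP Qf Pf indQ D c.
have [P0 PD PM] := idP; have [_ _ QM] := idQ.
have peel n (B : nat -> R) : (forall k, Q (B k) -> P (B k)) ->
    P (\sum_(k < n) f ^+ k * B k) -> forall k, (k < n)%N -> P (B k).
  move=> QPB; elim: n B QPB => // n IHn B QPB; rewrite big_ord_recl expr0 mul1r.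
  rewrite (eq_bigr (fun k : 'I_n => f * (f ^+ k * B k.+1))) => [|k _]; last by rewrite exprS mulrA.
  rewrite -mulr_sumr => PB; have PB0 : P (B 0%N).
    by apply: QPB; apply: (ideal_addr idQ _ (sub _ PB)); rewrite mulrC; apply: QM.
  move: PB; rewrite addrC => /(ideal_addr idP PB0)/Pm[/Pf//|PB].
  by case=> [//|k lt_k]; apply: (IHn (fun k => B k.+1)) => // j; exact: QPB.
(* [peel] shifts natural indices, so [B] is extended by 0 from [D] on. *)
pose B k := \sum_e (if insub k is Some i then c (i, e) else 0)%:~R * monomials e.
have BE (i : 'I_D) : B i = \sum_e (c (i, e))%:~R * monomials e by rewrite /B valK.
have QPB k : Q (B k) -> P (B k).
  move/indQ => Qc; apply: ideal_sum => // e; rewrite mulrC; apply: PM; exact: QP.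
move=> Pc [i e]; apply: QP; move: e; apply: indQ; rewrite -BE; apply: (sub).
apply: (peel D B QPB) => //.
rewrite (_ : \sum_(k < D) _ = \sum_i (c i)%:~R * monomials (ts := f :: ts) i) //.
rewrite [RHS](eq_bigr (fun p : 'I_D * box D (size ts) => (c (p.1, p.2))%:~R * (f ^+ p.1 * monomials p.2))) => [|[]//].
rewrite -(pair_bigA _ (fun i e => (c (i, e))%:~R * (f ^+ i * monomials e))) /=.
by apply: eq_bigr => k _; rewrite BE mulr_sumr; apply: eq_bigr => e' _; rewrite mulrCA.
Qed.

Lemma prime_chain_sub n (p : nat -> set R) i j : prime_chain n p -> (i <= j <= n)%N -> p i `<=` p j.
Proof.
move=> [_ lt_p] /andP[/subnK <-]; move: (j - i)%N => k; elim: k => [|k IHk] lt_kn //.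
have [sub _] := lt_p _ lt_kn; apply: subset_trans sub; exact: IHk (ltnW lt_kn).
Qed.

Lemma chain_alg_indep n (p : nat -> set R) ts : prime_chain n p -> alg_indep (p n) ts ->
  (forall c : int, p n c%:~R -> p 0%N c%:~R) ->
  exists ts', size ts' = (n + size ts)%N /\ alg_indep (p 0%N) ts'.
Proof.
elim: n ts => [|n IHn] ts chp indp int_p; first by exists ts.
have chp' : prime_chain n p.
  by case: chp => prp ltp; split=> i lt_in; [apply: prp|apply: ltp]; rewrite ltnW.
have sub0n : p 0%N `<=` p n by apply: (prime_chain_sub chp); rewrite /= ltnW.
have subS : p n `<=` p n.+1 by apply: (prime_chain_sub chp); rewrite leqnSn /=.
have [prp ltp] := chp; have [_ /existsNP[f /not_implyP[pf npf]]] := ltp n (leqnn _).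
have indf : alg_indep (p n) (f :: ts).
  apply: (alg_indep_cons (Q := p n.+1)) => //; try exact: prp.
  by move=> c /int_p/sub0n.
have [|ts' [sz ind']] := IHn _ chp' indf; first by move=> c /subS/int_p.
by exists ts'; rewrite sz /= addnS.
Qed.

(** The one step at which the contraction to the integers grows contributes no element, which
    accounts for the successor; below it all contractions are 0. *)
Lemma chain_alg_indep_mixed n (p : nat -> set R) ts : prime_chain n p -> alg_indep (p n) ts ->
  exists ts', (n + size ts <= (size ts').+1)%N /\ alg_indep (p 0%N) ts'.
Proof.
elim: n ts => [|n IHn] ts chp indp; first by exists ts.
have chp' : prime_chain n p.
  by case: chp => prp ltp; split=> i lt_in; [apply: prp|apply: ltp]; rewrite ltnW.
have subS : p n `<=` p n.+1 by apply: (prime_chain_sub chp); rewrite leqnSn /=.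
have [prp ltp] := chp; have [_ /existsNP[f /not_implyP[pf npf]]] := ltp n (leqnn _).
have [prn prS] := (prp n (leqnSn _), prp n.+1 (leqnn _)).
have [QP|P0] := prime_ideal_int_dichotomy prn prS subS.
  have [|ts' [sz ind']] := IHn (f :: ts) chp'.
    by apply: (alg_indep_cons (Q := p n.+1)).
  by exists ts'; rewrite addSn -addnS.
have [||ts' [sz ind']] := @chain_alg_indep n p ts chp'.
- by move=> D; apply: (lin_indep_sub prn prS subS).
- move=> c /P0 ->; have [[p00 _ _] _ _] := prp 0%N isT; exact: p00.
by exists ts'; rewrite sz addSn.
Qed.

End LinearIndependence.

(** * Bounding independent elements by the number of generators *)

Section TranscendenceBound.
Variables (R : comNzRingType) (P : set R) (k : nat) (g : 'I_k -> R) (h : R).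
Hypothesis prP : prime_ideal P.
Hypothesis Ph : ~ P h.
Local Notation ev := (mmap (intr : int -> R) g).
Hypothesis ev_h : exists G, ev G = h.
Hypothesis gen_P : forall F, exists e G, P (h ^+ e * F - ev G).

Let represented N F := exists G : {mpoly int[k]}, (msize G <= N.+1)%N /\ P (F - ev G).

Let idP : ideal P. Proof. by case: prP. Qed.

Let represented1 : represented 0 1.
Proof. by exists 1; rewrite msize1 rmorph1 subrr; split=> //; case: idP. Qed.

Let representedW N M F : (N <= M)%N -> represented N F -> represented M F.
Proof. by move=> NM [G [szG PG]]; exists G; split=> //; apply: leq_trans szG _. Qed.

Let representedM N M F F' : represented N F -> represented M F' -> represented (N + M) (F * F').
Proof.
move=> [G [szG PG]] [G' [szG' PG']]; exists (G * G'); split; last first.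
  have [_ PD PM] := idP; rewrite rmorphM /=.
  have -> : F * F' - ev G * ev G' = F' * (F - ev G) + ev G * (F' - ev G') by ring.
  by apply: PD; apply: PM.
have [->|G0] := eqVneq G 0; first by rewrite mul0r msize0.
have [->|G'0] := eqVneq G' 0; first by rewrite mulr0 msize0.
by rewrite msizeM_proper ?mulf_neq0 ?mleadc_eq0 //; lia.
Qed.

Let representedX N F l : represented N F -> represented (N * l) (F ^+ l).
Proof.
move=> FN; elim: l => [|l IHl]; first by rewrite muln0.
by rewrite mulnS exprS; apply: representedM.
Qed.

Let represented_gens (ts : seq R) : exists E d, forall t, t \in ts -> represented d (h ^+ E * t).
Proof.
have [H Hh] := ev_h; have rH : represented (msize H) h.
  by exists H; rewrite Hh subrr; split; [apply: leqnSn|case: idP].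
elim: ts => [|t ts [E [d tsP]]]; first by exists 0%N, 0%N.
have [e [G PG]] := gen_P t.
exists (E + e)%N, (maxn (msize H * e + d) (msize H * E + msize G)) => s.
rewrite inE => /predU1P[->|/tsP sP]; rewrite exprD.
  rewrite -mulrA; apply: representedW (leq_maxr _ _) _; apply: representedM (representedX _ rH) _.
  by exists G; rewrite leqnSn.
rewrite mulrAC mulrC; apply: representedW (leq_maxl _ _) _.
exact: representedM (representedX _ rH) sP.
Qed.

Let represented_monomials (ts : seq R) : exists E d, forall D (e : box D (size ts)),
  represented (d * D) (h ^+ (E * D) * monomials e).
Proof.
have [H Hh] := ev_h; have rH : represented (msize H) h.
  by exists H; rewrite Hh subrr; split; [apply: leqnSn|case: idP].
have [E [d tsP]] := represented_gens ts.
exists (E * size ts)%N, ((msize H * E + d) * size ts)%N => D.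
elim: ts tsP => [|t ts IHts] tsP /= e.
  by rewrite !muln0 !mul0n expr0 mulr1; exact: represented1.
case: e => i e /=.
(* The factor [t ^+ i] takes up [h ^+ (E * i)]; padding by [h ^+ (E * (D - i))] gives all monomials
   the same power of [h]. *)
have -> : h ^+ (E * (size ts).+1 * D) * (t ^+ i * monomials e) =
    (h ^+ (E * (D - i)) * (h ^+ E * t) ^+ i) * (h ^+ (E * size ts * D) * monomials e).
  have -> : (E * (size ts).+1 * D = E * (D - i) + E * i + E * size ts * D)%N.
    by rewrite -mulnDr subnK 1?ltnW //; lia.
  by rewrite exprMn -exprM !exprD; ring.
rewrite mulnS mulnDl; apply: representedM; last first.
  by apply: IHts => s sts; apply: tsP; rewrite inE sts orbT.
apply: (@representedW (msize H * (E * (D - i)) + d * i)).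
  rewrite mulnDl mulnA leq_add // leq_mul2l ?leq_subr ?orbT //.
  by rewrite (ltnW (ltn_ord i)) orbT.
by apply: representedM; apply: representedX => //; apply: tsP; rewrite inE eqxx.
Qed.

Lemma card_bmultinom N : (#|{: 'X_{1..k < N}}| <= N ^ k)%N.
Proof.
case: N => [|N].
  rewrite (_ : #|_| = 0%N) //; apply/eqP; rewrite -leqn0 leqNgt; apply/card_gt0P => -[m _].
  by have := bmdeg m.
have <- : #|{ffun 'I_k -> 'I_N.+1}| = (N.+1 ^ k)%N by rewrite card_ffun !card_ord.
apply: (leq_card (fun m : 'X_{1..k < N.+1} => [ffun i => inord (m i)] : {ffun 'I_k -> 'I_N.+1})).
move=> m m' /ffunP eq_mm'; apply: val_inj; apply/mnmP => i.
have lt_m (m1 : 'X_{1..k < N.+1}) : (m1 i < N.+1)%N.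
  apply: leq_ltn_trans (bmdeg m1); rewrite mdegE (bigD1 i) //=; exact: leq_addr.
by have := congr1 val (eq_mm' i); rewrite !ffunE /= !inordK.
Qed.

(* Comparing the [D^m] monomials with exponents [< D] in [m] elements with the
   [O(D^k)] monomials of degree [O(D)] in [k] generators. *)
Lemma alg_indep_size ts : alg_indep P ts -> (size ts <= k)%N.
Proof.
move=> indts; rewrite leqNgt; apply/negP => lt_k.
have [E [d rep]] := represented_monomials ts.
(* Chosen so that [N^k <= ((d + 1) D)^k < D^(k + 1) <= D^(size ts)]: more monomials than
   coefficients to cancel. *)
pose D := (d.+1 ^ k).+1; pose N := (d * D).+1.
have [G GP] := choice (rep D).
have [|c [[i0 ci0] ker]] := @int_kernel (box D (size ts)) 'X_{1..k < N} (fun e m => (G e)@_m).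
  apply: leq_ltn_trans (card_bmultinom N) _; rewrite card_box.
  apply: (@leq_trans (D ^ k.+1)); last by rewrite leq_pexp2l.
  rewrite expnS; apply: (@leq_ltn_trans ((d.+1 * D) ^ k)).
    have leN : (N <= d.+1 * D)%N by rewrite /N mulSn -[(d * D).+1]add1n leq_add2r.
    by case: (k) => [//|k']; rewrite leq_exp2r.
  by rewrite expnMn ltn_pmul2r // expn_gt0.
have [P0 PD PM] := idP; have [_ P1 Pm] := prP.
have Phn n : ~ P (h ^+ n).
  by elim: n => [|n IHn]; rewrite ?expr0 // exprS => /Pm[].
have [q qP] := ideal_int idP.
have q1 : q != 1%N by apply: contra_notN P1 => /eqP q1; apply/(qP 1); rewrite q1.
(* Independence modulo [P] only puts the coefficients in [(q)], the contraction of [P]. For nonzero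
   [q], dividing them by [q] preserves the relation among the [G e], so descent applies. *)
suff vanish n (c' : box D (size ts) -> int) :
    (forall m : 'X_{1..k < N}, \sum_e c' e * (G e)@_m = 0) -> (absz (c' i0) < n)%N -> c' i0 = 0.
  by case/eqP: ci0; apply: (vanish (absz (c i0)).+1).
elim: n c' {c ci0 ker} => // n IHn c ker lt_n.
have G0 : \sum_e (c e)%:~R * ev (G e) = 0.
  transitivity (ev (\sum_e c e *: G e)).
    by rewrite rmorph_sum; apply: eq_bigr => e _; rewrite /= mmapZ.
  rewrite (_ : \sum_e _ = 0) ?rmorph0 //; apply/mpolyP => m; rewrite mcoeff0 raddf_sum /=.
  have [lt_mN|le_Nm] := ltnP (mdeg m) N.
    by apply: etrans (ker (BMultinom lt_mN)); apply: eq_bigr => e _; exact: mcoeffZ.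
  rewrite big1 // => e _; rewrite mcoeffZ memN_msupp_eq0 ?mulr0 //.
  by apply: msize_mdeg_ge; apply: leq_trans le_Nm; have [] := GP e.
have Pc e : P (c e)%:~R.
  apply: indts; suff : P (h ^+ (E * D) * \sum_e (c e)%:~R * monomials e) by case/Pm => // /Phn.
  rewrite mulr_sumr (_ : \sum_e _ = \sum_e (c e)%:~R * (h ^+ (E * D) * monomials e - ev (G e))).
    by apply: ideal_sum => // e'; apply: PM; have [] := GP e'.
  transitivity (\sum_e ((c e)%:~R * (h ^+ (E * D) * monomials e) - (c e)%:~R * ev (G e))).
    by rewrite sumrB G0 subr0; apply: eq_bigr => e' _; exact: mulrCA.
  by apply: eq_bigr => e' _; rewrite mulrBr.
have qc e : (q%:Z %| c e)%Z by apply/qP.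
have qE e : c e = (c e %/ q)%Z * q by rewrite divzK.
have [q0|qN0] := eqVneq q 0%N; first by have := qc i0; rewrite q0 dvd0z => /eqP.
have [ci0|ciN] := eqVneq (c i0) 0; first by [].
rewrite qE (IHn (fun e => c e %/ q)%Z) ?mul0r // => [m|]; last first.
  have : (absz (c i0 %/ q)%Z * q = absz (c i0))%N by rewrite {2}qE abszM.
  have : (0 < absz (c i0))%N by rewrite absz_gt0.
  by nia.
apply: (mulfI (_ : q%:Z != 0)) => //.
by rewrite mulr0 mulr_sumr -[RHS](ker m); apply: eq_bigr => e _; rewrite {2}qE; ring.
Qed.

End TranscendenceBound.

(** * Primes of R *)

Lemma xP_neq0 i : xP int i <> 0 :> {poly {mpoly int[3]}}.
Proof.
rewrite /xP -polyC0 => /polyC_inj/(congr1 (mcoeff U_(i)%MM)).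
by rewrite mcoeffXU eqxx mcoeff0.
Qed.

(** The minor squares to 0 but has the nonzero normal derivative [xP int 1]. *)
Lemma ringR_not_reduced : ~ reduced ringR.
Proof.
move=> /(_ (minorR 0 1) 2 (minorR_mul0 _ _ _ _)) m0; apply: (@xP_neq0 1).
have comb (S : comNzRingType) (a b : S) : true%:R * a - false%:R * b = a.
  by rewrite mul1r mul0r subr0.
rewrite -[LHS](comb _ _ (xP int 0)) -(normal_minorR 0 0 1) m0.
by have := normalD 0 0 0; rewrite addr0 => /(canLR (addrK _)); rewrite subrr.
Qed.

Lemma prime_ideal_ker (R : comNzRingType) (S : idomainType) (f : {rmorphism R -> S}) :
  prime_ideal [set r | f r = 0].
Proof.
split; first split=> /= [|a b a0 b0|r a a0]; rewrite ?rmorph0 //=.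
- by rewrite rmorphD a0 b0 addr0.
- by rewrite rmorphM a0 mulr0.
- by rewrite rmorph1 => /eqP; rewrite oner_eq0.
by move=> a b /=; rewrite rmorphM => /eqP; rewrite mulf_eq0 => /orP[]/eqP; [left|right].
Qed.

Lemma prime_ideal_dvdz (R : comNzRingType) (f : {rmorphism R -> int}) q : prime q ->
  prime_ideal [set r | (q %| f r)%Z].
Proof.
move=> prq; split; first split=> /= [|a b qa qb|r a qa].
- by rewrite rmorph0 dvdz0.
- by rewrite rmorphD rpredD.
- by rewrite rmorphM dvdz_mull.
- by rewrite /= rmorph1 dvdz1 /=; case: q prq => [|[|q]].
move=> a b; rewrite /= rmorphM /= !dvdzE abszM Euclid_dvdM //.
by move=> /orP[]; [left|right].
Qed.

Section DimensionBound.
Variable Q : set ringR.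
Hypothesis prQ : prime_ideal Q.

Let minor_mem i j : Q (minorR i j).
Proof.
have [[Q0 _ _] _ Qm] := prQ.
by have /Qm[] : Q (minorR i j * minorR i j) by rewrite minorR_mul0.
Qed.

Let gen_closed k (g : 'I_k -> ringR) h (H : {mpoly int[k]}) : mmap intr g H = h ->
  (forall i, exists e G, Q (h ^+ e * xR i - mmap intr g G)) ->
  (forall i, exists e G, Q (h ^+ e * uR i - mmap intr g G)) ->
  forall r, exists e G, Q (h ^+ e * r - mmap intr g G).
Proof.
move=> Hh Qx Qu; have [idQ _ _] := prQ; have [Q0 QD QM] := idQ.
elim/ringR_ind => [|r s [e [G rG]] [e' [G' sG]]|r s [e [G rG]] [e' [G' sG]]|i|i] //.
- by exists 0%N, 1; rewrite rmorph1 mulr1 expr0 subrr.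
- exists (e + e')%N, (H ^+ e' * G - H ^+ e * G'); rewrite rmorphB !rmorphM !rmorphXn /= Hh.
  have -> : h ^+ (e + e') * (r - s) - (h ^+ e' * mmap intr g G - h ^+ e * mmap intr g G') =
    h ^+ e' * (h ^+ e * r - mmap intr g G) - h ^+ e * (h ^+ e' * s - mmap intr g G').
    by rewrite exprD; ring.
  by apply: idealB => //; apply: QM.
- exists (e + e')%N, (G * G'); rewrite rmorphM /=.
  have -> : h ^+ (e + e') * (r * s) - mmap intr g G * mmap intr g G' =
    (h ^+ e' * s) * (h ^+ e * r - mmap intr g G) + mmap intr g G * (h ^+ e' * s - mmap intr g G').
    by rewrite exprD; ring.
  by apply: QD; apply: QM.
Qed.

Lemma alg_indep_ringR ts : alg_indep Q ts -> (size ts <= 4)%N.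
Proof.
move=> indts; have [idQ Q1 _] := prQ; have [Q0 QD QM] := idQ.
have [[i Qi]|Qx] := EM (exists i, ~ Q (xR i)).
  (* The minors lie in [Q], so [x_0, x_1, x_2, u_i] generate after inverting [x_i]:
     [u_j = u_i x_j / x_i]. *)
  pose g (k : 'I_4) := if unlift ord_max k is Some j then xR j else uR i.
  have gx j : mmap intr g 'X_(lift ord_max j) = xR j by rewrite mmapX mmap1U /g liftK.
  have gu : mmap intr g 'X_ord_max = uR i by rewrite mmapX mmap1U /g unlift_none.
  have ev_h : exists G, mmap intr g G = xR i by exists 'X_(lift ord_max i).
  apply: (alg_indep_size prQ Qi ev_h) => //.
  apply: (gen_closed (gx i)) => j.
    by exists 0%N, 'X_(lift ord_max j); rewrite gx mul1r subrr.
  exists 1%N, ('X_ord_max * 'X_(lift ord_max j)).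
  have -> : mmap intr g ('X_ord_max * 'X_(lift ord_max j)) = uR i * xR j.
    by rewrite rmorphM /= gx gu.
  by have := minor_mem j i; rewrite /minorR mulrC expr1.
(* Here all [x_j] lie in [Q], so the [u_j] generate; a zero pads the list to four. *)
pose g (k : 'I_4) := if unlift ord_max k is Some j then uR j else 0.
have gu j : mmap intr g 'X_(lift ord_max j) = uR j by rewrite mmapX mmap1U /g liftK.
have g1 : mmap intr g 1 = 1 by rewrite rmorph1.
have ev_h : exists G, mmap intr g G = 1 by exists 1.
apply: (alg_indep_size prQ Q1 ev_h) => //.
apply: (gen_closed g1) => j.
  exists 0%N, 0; rewrite rmorph0 subr0 mul1r.
  by apply: contrapT => Qj; apply: Qx; exists j.
by exists 0%N, 'X_(lift ord_max j); rewrite gu mul1r subrr.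
Qed.

End DimensionBound.

(** * Explicit primes, the dimension of [R] and the height of [J] *)

Definition kill0 (j : nat) : {rmorphism zpoly6 -> zpoly6} :=
  mmap intr (fun k : 'I_6 => if (k < 3 + j)%N then 0 else 'X_k).

Lemma kill0_X j k : kill0 j 'X_k = if (k < 3 + j)%N then 0 else 'X_k.
Proof. by rewrite /kill0 /= mmapX mmap1U. Qed.

Lemma kill0_xvar j (i : 'I_3) : kill0 j (xvar i) = 0.
Proof.
have [lt6 _] := ord3_lt6 i.
by rewrite /xvar kill0_X inordK // (leq_trans (ltn_ord i)) // leq_addr.
Qed.

Lemma kill0_uvar j (i : 'I_3) : kill0 j (uvar i) = if (i < j)%N then 0 else uvar i.
Proof.
have [_ lt6] := ord3_lt6 i.
by rewrite /uvar kill0_X inordK // ltn_add2l.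
Qed.

Lemma kill0_minor j (a b : 'I_3) : kill0 j (xu_minor a b) = 0.
Proof. have zero (S : comNzRingType) (s t : S) : 0 * s - 0 * t = 0 by rewrite !mul0r subrr.
by rewrite rmorph_minor (kill0_xvar j a) (kill0_xvar j b); exact: zero. Qed.

Definition kill j : {rmorphism ringR -> zpoly6} := descend_rmorphism (kill0_minor j).

Lemma kill_cls j p : kill j (cls p) = kill0 j p.
Proof. exact: (descend_cls (kill0_minor j)). Qed.

Lemma kill_xR j i : kill j (xR i) = 0.
Proof. by rewrite kill_cls kill0_xvar. Qed.

Lemma kill_uR j i : kill j (uR i) = if (i < j)%N then 0 else uvar i.
Proof. by rewrite kill_cls kill0_uvar. Qed.

Lemma ringR_sub (Q : set ringR) (f : {rmorphism ringR -> ringR}) : ideal Q ->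
  (forall i, Q (xR i - f (xR i))) -> (forall i, Q (uR i - f (uR i))) -> forall r, Q (r - f r).
Proof.
move=> idQ Qx Qu; have [Q0 QD QM] := idQ.
elim/ringR_ind => [|r s Qr Qs|r s Qr Qs|i|i] //; first by rewrite rmorph1 subrr.
- rewrite rmorphB (_ : r - s - (f r - f s) = (r - f r) - (s - f s)); last by ring.
  exact: idealB.
- rewrite rmorphM (_ : r * s - f r * f s = s * (r - f r) + f r * (s - f s)); last by ring.
  by apply: QD; apply: QM.
Qed.

(** The ideal generated by the [x_i] and the first [j] of the [u_i]; as the kernel of a map to a
    domain it is prime at once. *)
Definition kill_ideal j : set ringR := [set r | kill j r = 0].

Lemma kill_ideal_prime j : prime_ideal (kill_ideal j).
Proof. exact: prime_ideal_ker. Qed.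

Lemma kill_idealS j : kill_ideal j `<=` kill_ideal j.+1.
Proof.
move=> r r0; have [id1 _ _] := kill_ideal_prime j.+1.
(* [cls \o kill j] only moves generators that lie in the larger ideal. *)
have : kill_ideal j.+1 (r - cls (kill j r)).
  apply: (@ringR_sub _ (cls \o kill j) id1) => i; apply: (etrans (rmorphB _ _ _)).
    by rewrite [X in _ - kill _ (cls X)]kill_xR kill_xR !rmorph0 subrr.
  rewrite [X in _ - kill _ (cls X)]kill_uR; have [lt_ij|le_ji] := ltnP i j.
    by rewrite kill_uR ltnS ltnW // !rmorph0 subrr.
  exact: subrr.
have -> : kill j r = 0 by exact: r0.
by rewrite (rmorph0 cls) subr0.
Qed.

Lemma constant_kill j r : (kill j r)@_0%MM = constant r.
Proof.
elim/ringR_ind: r => [|r s IHr IHs|r s IHr IHs|i|i].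
- by rewrite !rmorph1.
- transitivity ((kill j r)@_0%MM - (kill j s)@_0%MM).
    exact: etrans (congr1 (mcoeff 0%MM) (rmorphB (kill j) r s)) (mcoeffB _ _ _).
  exact: etrans (congr2 (fun a b => a - b) IHr IHs) (esym (rmorphB constant r s)).
- rewrite (rmorphM (kill j)) (rmorphM constant) -IHr -IHs.
  exact: (rmorphM (mcoeff 0%MM : {rmorphism zpoly6 -> int})).
- by rewrite kill_xR constant_xR mcoeff0.
rewrite kill_uR constant_uR; case: ifP => _; first exact: mcoeff0.
by rewrite mcoeffX mnm1_eq0.
Qed.

Lemma kill_ideal_constant j r : kill_ideal j r -> constant r = 0.
Proof.
by move=> r0; rewrite -(constant_kill j) (_ : kill j r = 0) ?mcoeff0 //; exact: r0.
Qed.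

Lemma uvar_neq0 i : uvar i != 0.
Proof.
by apply/eqP => /(congr1 (mcoeff U_(inord (3 + i))%MM)); rewrite mcoeffXU eqxx mcoeff0.
Qed.

Lemma xR_in_kill_ideal j i : kill_ideal j (xR i).
Proof. exact: kill_xR. Qed.

Lemma uR_in_kill_ideal j (i : 'I_3) : kill_ideal j (uR i) <-> (i < j)%N.
Proof.
split=> [k0|lt_ij]; last by apply: etrans (kill_uR _ _) _; rewrite lt_ij.
have := kill_uR j i; rewrite [LHS]k0; case: ifP => // _ /esym/eqP.
by rewrite (negbTE (uvar_neq0 _)).
Qed.

Local Notation J := (ideal_gen [set xR 0; xR 1; xR 2%:R]).

Lemma xR_gen i : [set xR 0; xR 1; xR 2%:R] (xR i).
Proof.
case: i => [[|[|[|//]]] lt_i].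
- by left; left; congr xR; apply: val_inj.
- by left; right; congr xR; apply: val_inj.
- by right; congr xR; apply: val_inj.
Qed.

Lemma kill_ideal0 : kill_ideal 0 = J.
Proof.
have [idK _ _] := kill_ideal_prime 0; apply/seteqP; split; last first.
  by apply: (ideal_gen_sub idK) => _ [[->|->]|->]; exact: xR_in_kill_ideal.
move=> r r0; have idJ : ideal J by exact: ideal_genP.
have : J (r - cls (kill 0 r)).
  apply: (@ringR_sub _ (cls \o kill 0) idJ) => i; last first.
    rewrite [X in _ - X](_ : _ = uR i) ?subrr; first by case: idJ.
    by congr cls; rewrite kill_uR.
  rewrite [X in _ - X](_ : _ = 0) ?subr0; last by apply: etrans (rmorph0 cls); congr cls; exact: kill_xR.
  apply: sub_ideal_gen; apply: xR_gen.
have -> : kill 0 r = 0 by exact: r0.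
by rewrite (rmorph0 cls) subr0.
Qed.

(* The rank-one locus in the parametrization [x_i = a u_i]; the kernel is the
   minimal prime of [R]. *)
Definition cone0 : {rmorphism zpoly6 -> {poly zpoly6}} :=
  mmap intr (fun k : 'I_6 => if (k < 3)%N then 'X * (uvar k)%:P else ('X_k)%:P).

Lemma cone0_xvar (i : 'I_3) : cone0 (xvar i) = 'X * (uvar i)%:P.
Proof.
have [lt6 _] := ord3_lt6 i.
by rewrite /cone0 /= mmapX mmap1U inordK // ltn_ord.
Qed.

Lemma cone0_uvar (i : 'I_3) : cone0 (uvar i) = (uvar i)%:P.
Proof.
have [_ lt6] := ord3_lt6 i.
by rewrite /cone0 /= mmapX mmap1U inordK // ltnNge leq_addr.
Qed.

Lemma cone0_minor (i j : 'I_3) : cone0 (xu_minor i j) = 0.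
Proof.
have swap (S : comNzRingType) (a b c : S) : a * b * c - a * c * b = 0 by ring.
by rewrite rmorph_minor (cone0_xvar i) (cone0_xvar j) (cone0_uvar i) (cone0_uvar j); exact: swap.
Qed.

Definition cone : {rmorphism ringR -> {poly zpoly6}} := descend_rmorphism cone0_minor.

Lemma cone_cls p : cone (cls p) = cone0 p.
Proof. exact: (descend_cls cone0_minor). Qed.

Lemma cone_kill r : (cone r)`_0 = kill 0 r.
Proof.
elim/ringR_ind: r => [|r s IHr IHs|r s IHr IHs|i|i].
- by rewrite !rmorph1 coef1.
- by rewrite !rmorphB coefB IHr IHs.
- by rewrite !rmorphM coef0M IHr IHs.
- by rewrite kill_xR /xR cone_cls cone0_xvar coefXM.
- by rewrite kill_uR /uR cone_cls cone0_uvar coefC.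
Qed.

(* cone < (x) < (x,u_0) < (x,u_0,u_1) < (x,u) < (x,u,2) *)
Definition long_chain (n : nat) : set ringR :=
  match n with
  | 0 => [set r | cone r = 0]
  | 4 => [set r | constant r = 0]
  | 5 => [set r | (2 %| constant r)%Z]
  | m.+1 => kill_ideal m
  end.

Definition point (q : nat) : set ringR := [set r | (q %| constant r)%Z].

Lemma point_prime q : prime q -> prime_ideal (point q).
Proof. by move=> prq; exact: prime_ideal_dvdz. Qed.

Lemma point_nat q (l : nat) : point q l%:R = (q %| l)%N.
Proof. by rewrite /point /mkset rmorph_nat natz. Qed.

Lemma long_chainP : prime_chain 5 long_chain.
Proof.
split=> [[|[|[|[|[|[|//]]]]]]|[|[|[|[|[|//]]]]]] _.
- exact: prime_ideal_ker.
- exact: kill_ideal_prime.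
- exact: kill_ideal_prime.
- exact: kill_ideal_prime.
- exact: prime_ideal_ker.
- exact: (@point_prime 2).
- split=> [r r0|sub].
    have k0 : cone r = 0 by exact: r0.
    by apply: etrans (esym (cone_kill r)) _; rewrite k0 coef0.
  have : cone (xR 0) = 0 by exact: sub (xR_in_kill_ideal 0 0).
  rewrite /xR cone_cls cone0_xvar => /eqP; rewrite mulf_eq0 polyX_eq0 polyC_eq0.
  by rewrite (negbTE (uvar_neq0 _)).
- split=> [|sub]; first exact: kill_idealS.
  by have /uR_in_kill_ideal := sub (uR 0) ((uR_in_kill_ideal 1 0).2 isT).
- split=> [|sub]; first exact: kill_idealS.
  by have /uR_in_kill_ideal := sub (uR 1) ((uR_in_kill_ideal 2 1).2 isT).
- split=> [r /kill_ideal_constant//|sub].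
  by have /uR_in_kill_ideal := sub (uR 2%:R) (constant_uR _).
split=> [r r0|sub].
  have c0 : constant r = 0 by exact: r0.
  by change (is_true (2 %| constant r)%Z); rewrite c0.
have : constant 2%:R = 0.
  by apply: sub; change (is_true (2 %| constant 2%:R)%Z); rewrite rmorph_nat.
by rewrite rmorph_nat.
Qed.

Lemma krull_dim_ringR : krull_dim_is ringR 5.
Proof.
split; first by exists long_chain; exact: long_chainP.
move=> n p chp; have [ts [le_n indts]] := chain_alg_indep_mixed chp (@alg_indep_nil _ (p n)).
have prp0 : prime_ideal (p 0%N) by apply: (chp.1).
have := alg_indep_ringR prp0 indts; move: le_n; rewrite /= addn0; lia.
Qed.

Lemma kill_ideal_int j (c : int) : kill_ideal j c%:~R -> c = 0.
Proof. by move/kill_ideal_constant; rewrite rmorph_int intz. Qed.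

(** The stretch of [long_chain] from [J] to [(x, u)] meets the integers in 0 throughout, so each of
    its three steps yields an independent element. *)
Lemma kill_ideal_alg_indep : exists ts, size ts = 3 /\ alg_indep (kill_ideal 0) ts.
Proof.
have chp : prime_chain 3 (fun i => long_chain i.+1).
  by have [pr lt] := long_chainP; split=> i le_i; [apply: pr|apply: lt]; lia.
have [|ts [sz ind]] := chain_alg_indep chp (@alg_indep_nil _ _).
  move=> c c0; have : constant c%:~R = 0 by exact: c0.
  by rewrite rmorph_int intz => ->; exact: rmorph0.
by exists ts; rewrite sz.
Qed.

(** Along a chain of length [n] ending at [J], the three elements independent modulo [J] grow to
    [n + 3] independent modulo the first prime, and four is the maximum. *)
Lemma height_kill_ideal0 : height_is (kill_ideal 0) 1.
Proof.
split.
  exists long_chain => //; have [pr lt] := long_chainP.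
  by split=> i le_i; [apply: pr|apply: lt]; apply: leq_trans le_i _.
move=> n p chp pn; have [ts [sz indts]] := kill_ideal_alg_indep.
rewrite -pn in indts; have [|ts' [sz' indts']] := chain_alg_indep chp indts.
  have [[p00 _ _] _ _] := chp.1 0%N isT.
  by move=> c; rewrite pn => /kill_ideal_int ->.
have := alg_indep_ringR (chp.1 0%N isT) indts'; rewrite sz' sz; lia.
Qed.

(** * Support and minimal primes of [H^2_J(R)] *)

Section Support.
Variable I : injective_resolution (ringR^o)%R.
Local Notation H2 := (local_cohomology J I 2).

Lemma support_annihilator (M : lmodType ringR) Q : Defs.support M Q ->
  exists m : M, forall g, g *: m = 0 -> Q g.
Proof.
move=> [prQ [[m s] _ Nx]]; exists m => g gm; apply: contrapT => Qg; apply: Nx.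
by exists g => //=; rewrite scale1r scaler0 subr0.
Qed.

Lemma point_support q : prime q -> Defs.support H2 (point q).
Proof.
move=> prq; split; first exact: point_prime.
(* The class of [t^(q-1)] is killed only by elements with constant term divisible by [q]. *)
have [z zP] := H2_class I q.-1; exists (z, 1) => /=.
  by have [_] := point_prime prq.
case=> t Nt; rewrite scale1r scaler0 subr0 => /zP.
by rewrite prednK ?prime_gt0.
Qed.

(** [Q] contains the annihilator of some class, hence all elements without constant term and a
    positive integer. A prime factor of the latter lies in [Q], thus in [point q], and must be
    [q]. *)
Lemma support_point q Q : prime q -> Defs.support H2 Q -> Q `<=` point q -> Q = point q.
Proof.
move=> prq suppQ sub; have [prQ _] := suppQ; have [[Q0 QD QM] Q1 Qm] := prQ.
have [z zQ] := support_annihilator suppQ.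
have [zconst [c c_gt0 zc]] := H2_annihilators z.
have [l prl Ql] := prime_ideal_nat prQ c_gt0 (zQ _ zc).
have Qq : Q q%:R.
  by have := sub _ Ql; rewrite point_nat dvdn_prime2 // => /eqP ->.
apply/seteqP; split=> // r /dvdzP[e rE].
rewrite -[r](subrK (constant r)%:~R); apply: QD.
  by apply/zQ/zconst; rewrite rmorphB rmorph_int intz subrr.
by rewrite rE intrM; apply: QM.
Qed.

Lemma point_minimal q : prime q -> minimal_primes H2 (point q).
Proof. by move=> prq; split=> [|Q]; [exact: point_support|exact: support_point]. Qed.

Lemma infinite_minimal_primes : infinite_set (minimal_primes H2).
Proof.
pose q n := iter n (fun m => s2val (prime_above m)) 2.
have prq n : prime (q n) by case: n => [//|n]; rewrite /q /=; case: prime_above.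
have q_lt n : (q n < q n.+1)%N by rewrite /q /=; case: prime_above.
have q_inj : injective q.
  move=> m n; have q_mono := homo_ltn ltn_trans q_lt.
  by case: (ltngtP m n) => // /q_mono lt_q eq_q; rewrite eq_q ltnn in lt_q.
move=> fin; apply: infinite_nat.
have := @finite_preimage nat _ (minimal_primes H2) (point \o q) _ fin.
rewrite (_ : _ @^-1` _ = [set: nat]) => [fin_nat|]; last first.
  by apply/seteqP; split=> // n _; exact: point_minimal.
apply: fin_nat => m n _ _ /= pE; apply: q_inj.
have : point (q n) (q m)%:R by rewrite -pE point_nat.
by rewrite point_nat dvdn_prime2 // => /eqP.
Qed.

End Support.

Local Close Scope quotient_scope.
Local Close Scope ring_scope.
Local Close Scope classical_set_scope.

Theorem theorem1p3 :
  [/\ ~ reduced ringR,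
      krull_dim_is ringR 5
    & exists J : set ringR,
        [/\ prime_ideal J,
            height_is J 1
          & forall I : injective_resolution (ringR^o)%R,
              infinite_set (minimal_primes (local_cohomology J I 2))]].
Proof.
split; [exact: ringR_not_reduced|exact: krull_dim_ringR|].
exists J; split; first by rewrite -kill_ideal0; exact: kill_ideal_prime.
  by rewrite -kill_ideal0; exact: height_kill_ideal0.
exact: infinite_minimal_primes.
Qed.
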